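(* For every integer $t>1$ there exists $n_0=n_0(t)$ such that for all $n\ge n_0$, $$\mathrm{ex}_3(n,B_t^3)=t\binom{n-t}{2}.$$
   Context: For an $r$-uniform hypergraph $\mathcal{F}$, the Turán number $\mathrm{ex}_r(n,\mathcal{F})$ is the maximum number of hyperedges in an $n$-vertex $r$-uniform hypergraph that does not contain $\mathcal{F}$ as a (not necessarily induced) subhypergraph. For a graph $F$, the $r$-expansion $F^r$ is the $r$-uniform hypergraph obtained from $F$ by adding $r-2$ new vertices to each edge of $F$, where the new vertices added to different edges are all distinct (so $F^r$ has $(r-2)|E(F)|+|V(F)|$ vertices and $|E(F)|$ hyperedges). The book graph $B_t$ is the graph on $t+2$ vertices $u,v,x_1,\dots,x_t$ with edges $uv$ and $ux_i, vx_i$ for $i=1,\dots,t$; that is, it consists of $t$ triangles sharing exactly one common edge. *)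

(* Defs.v *)
From mathcomp Require Import all_boot.

Set Implicit Arguments.
Unset Strict Implicit.
Unset Printing Implicit Defensive.

(* A hypergraph on a finite vertex type is given by its set of hyperedges;
   graphs are the 2-uniform ones. *)
Definition hypergraph (V : finType) := {set {set V}}.

Definition uniform (r : nat) (V : finType) (H : hypergraph V) : bool :=
  [forall e in H, #|e| == r].

(* H contains a copy of F as a not necessarily induced subhypergraph. *)
Definition contains (U V : finType) (F : hypergraph U) (H : hypergraph V) : bool :=
  [exists f : {ffun U -> V},
     injectiveb f && [forall e in F, (f @: e) \in H]].

Definition turan_number (r n : nat) (U : finType) (F : hypergraph U) : nat :=
  \max_(H : hypergraph 'I_n | uniform r H && ~~ contains F H) #|H|.

(* Besides the vertices of G, the expansion has one vertex (e, i) for every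
   edge e of G and every i < r - 2. *)
Definition expansion_vertex (r : nat) (V : finType) (G : hypergraph V) : finType :=
  (V + {e : {set V} | e \in G} * 'I_(r - 2))%type.

Definition expansion (r : nat) (V : finType) (G : hypergraph V) :
    hypergraph (expansion_vertex r G) :=
  [set (inl @: val e) :|: [set inr (e, i) | i : 'I_(r - 2)]
     | e : {e : {set V} | e \in G}].

(* u and v are inl true and inl false, and x_i is inr i. *)
Definition book (t : nat) : hypergraph (bool + 'I_t)%type :=
  [set inl true; inl false]
    |: [set [set inl b; inr i] | b : bool, i : 'I_t].

(* Main.v *)
Require Import Defs.
From mathcomp Require Import all_boot all_order all_algebra zify ring.

(** The extremal hypergraph consists of all triples that meet a fixed set [S] of [t] vertices in
exactly one vertex; it has [t * 'C(n - t, 2)] hyperedges. It contains no copy of the expanded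
book: the preimage of [S] in a copy would meet every hyperedge of the expansion in exactly one
vertex, and such a crosscut has more than [t] elements ([card_crosscut]).

For the upper bound, a 3-uniform hypergraph is read as a symmetric ternary relation [h] without a
copy of the expanded book. [N x y] is the set of third vertices of the triples through [x y], and
[d x y] its size. All sums run over ordered tuples, so that [triples h], the sum of all [d x y],
is six times the number of hyperedges.

Completion. Call the pair [x y] rich if [d x y > 3 * t]. A copy of the expanded book is a core
[u v], a triple [u v w], and [t] cherries: a spine [s] with triples [u s e] and [v s f]. A triple
of a cherry may be replaced by a rich pair, because a rich pair extends to a triple that avoids
the rest of the copy ([complete_book]). Hence two vertices in a common triple have at most [t]
common rich neighbours ([card_common_rich]), and several other configurations around a core are
bounded ([card_busy_spines], [card_high_apex]).

Weights. Every triple divides six units among its three pairs, in a way that depends only on which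
of the pairs are rich and which have [d <= t]. In the extremal example all six go to the pair
outside [S], so nearly every pair has weight [6 * t]. No pair has weight above [12 * t - 3]
([weight_max]), which already gives a bound of the right order in terms of the number of pairs
covered by triples ([triples_shadow]). Pairs of weight above [6 * t], called heavy, do occur, but
they cluster: if [x] is heavy with both [v] and [z], then usually [v z] lies in no triple
([heavy_clustering]). By the AM-GM inequality there are then, up to an error of [o(n ^ 2)], at
least as many pairs of weight [0] as heavy pairs, and a heavy pair gains less than an empty one
loses. So in a hypergraph with at least [t * 'C(n - t, 2)] hyperedges all but [o(n ^ 2)] pairs
have weight exactly [6 * t] ([few_bad_pairs]).

Structure. If all pairs around [a b c] have weight [6 * t] and the triples through them meet no
accidental cherries, then [N a b], [N a c] and [N b c] are tightly linked ([balanced_witness]);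
for a pair [a b] with more than [3 * t] such [c] this forces [N a b] to be the set of common rich
neighbours of [a] and [b], and to have [t] elements ([balanced_settled]). This holds for all but
[o(n ^ 2)] pairs, and the members of [N a b] even have codegree linear in [n] with [a]
([nonfirm_le]). Only boundedly many vertices have linear codegree with a typical [x], so some set
[S] equals [N x z] for a positive proportion of the [z]. A second such set, coming from a vertex
that is not rich to all of [S], would give linearly many vertices with more than [t] rich
neighbours in common, hence too many empty pairs. So nearly all vertices are rich to all of [S]
([exists_kernel]).

Exact count. Let [k] be the number of vertices outside [S] that are not rich to all of [S]. No
triple contains two vertices of [S], and a triple outside [S] contains at least two of these [k]
loose vertices. Counted with order, the loose vertices destroy about [2 * k * n] triples that meet
[S] ([star_gaps_ge]), whereas the triples with two loose vertices contribute at most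
[k * n + o(k * n)] ([sum_loose_loose]). So [k > 0] is a loss, and the bound
[triples h <= 3 * t * (n - t) * (n - t - 1)] follows for every large [n]
([triples_upper_bound]). *)

Set Implicit Arguments.
Unset Strict Implicit.
Unset Printing Implicit Defensive.

(** * Triple systems, books and partial cherries *)

Record triple_system (V : finType) := TripleSystem {
  adj :> V -> V -> V -> bool;
  adjC : forall x y z, adj x y z = adj y x z;
  adjA : forall x y z, adj x y z = adj x z y;
  adj_neq : forall x y z, adj x y z -> x != y }.

Section Representatives.

Variable V : finType.

Lemma ex_notin_seq (A : {set V}) (s : seq V) :
  size s < #|A| -> exists2 x, x \in A & x \notin s.
Proof.
move=> lts; case: (pickP [pred x | (x \in A) && (x \notin s)]) => [x /andP[]|sA].
  by exists x.
suff: #|A| <= size s by lia.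
apply: leq_trans (card_size s); apply: subset_leq_card; apply/subsetP => x xA.
by move: (sA x); rewrite /= xA /= => /negbFE.
Qed.

Lemma distinct_representatives (l : seq {set V}) :
  (forall A, A \in l -> size l <= #|A|) ->
  exists r : seq V, [/\ size r = size l, uniq r & all2 (fun (A : {set V}) x => x \in A) l r].
Proof.
elim: l => [|A l IHl] lA; first by exists [::].
have [|r [szr unr lr]] := IHl.
  by move=> B Bl; apply: leq_trans (lA B _) => //=; rewrite inE Bl orbT.
have [|x xA xr] := @ex_notin_seq A r; first by rewrite szr lA ?mem_head.
by exists (x :: r); rewrite /= szr xr xA.
Qed.

End Representatives.

Section Cherries.

Variables (V : finType) (h : triple_system V) (t : nat).

Lemma adj_neq12 x y z : h x y z -> x != y. Proof. exact: adj_neq. Qed.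
Lemma adj_neq13 x y z : h x y z -> x != z.
Proof. by rewrite adjA; apply: adj_neq. Qed.
Lemma adj_neq23 x y z : h x y z -> y != z.
Proof. by rewrite adjC adjA; apply: adj_neq. Qed.

Lemma adjR x y z : h x y z = h y z x.
Proof. by rewrite adjC adjA. Qed.

Definition nbr x y := [set z | h x y z].
Definition codeg x y := #|nbr x y|.
Definition rich x y := 3 * t < codeg x y.

Lemma nbrC x y : nbr x y = nbr y x.
Proof. by apply/setP=> z; rewrite !inE adjC. Qed.
Lemma codegC x y : codeg x y = codeg y x.
Proof. by rewrite /codeg nbrC. Qed.
Lemma richC x y : rich x y = rich y x.
Proof. by rewrite /rich codegC. Qed.
Lemma in_nbr x y z : (z \in nbr x y) = h x y z. Proof. by rewrite inE. Qed.
Lemma nbr_id x : nbr x x = set0.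
Proof. by apply/setP=> z; rewrite !inE; apply/negP => /adj_neq; rewrite eqxx. Qed.
Lemma rich_neq x y : rich x y -> x != y.
Proof. by apply: contraTneq => ->; rewrite /rich /codeg nbr_id cards0. Qed.

Definition cherry (u v : V) (c : V * V * V) := h u c.1.1 c.1.2 && h v c.1.1 c.2.
Definition cherry_vertices (c : V * V * V) := [:: c.1.1; c.1.2; c.2].

(** The pages are encoded by cherries [(s, e, f)]: the spine vertex [s] is joined to the core
[u v] by the hyperedges [u s e] and [v s f], and [u v w] is the hyperedge of the core. *)
Definition has_book := exists u v w (cs : seq (V * V * V)),
  [/\ size cs = t, h u v w, all (cherry u v) cs &
      uniq [:: u, v, w & flatten (map cherry_vertices cs)]].

(** [None] is a hole: the hyperedge on that side is replaced by a rich pair. *)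
Definition partial_cherry (u v : V) (p : V * option V * option V) :=
  (if p.1.2 is Some e then h u p.1.1 e else rich u p.1.1) &&
  (if p.2 is Some f then h v p.1.1 f else rich v p.1.1).
Definition partial_vertices (p : V * option V * option V) :=
  p.1.1 :: (seq_of_opt p.1.2 ++ seq_of_opt p.2).
Definition holes (p : V * option V * option V) := ~~ p.1.2 + ~~ p.2.

Lemma size_partial_vertices ps :
  size (flatten (map partial_vertices ps)) + sumn (map holes ps) = 3 * size ps.
Proof.
elim: ps => [|[[s [e|]] [f|]] ps IH] //=; rewrite /holes /=; move: IH;
  set a := size _; set b := sumn _; lia.
Qed.

(** Fill the holes one at a time. A book has [3 * t + 3] vertices, so a rich pair always has a
third vertex outside the part that is already there. *)
Lemma complete_book u v w ps : size ps = t -> h u v w ->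
  all (partial_cherry u v) ps ->
  uniq [:: u, v, w & flatten (map partial_vertices ps)] -> has_book.
Proof.
have [k] := ubnP (sumn (map holes ps)).
elim: k ps => // k IHk ps lek szps huvw psP psU.
have [ps0|] := posnP (sumn (map holes ps)).
  pose c (p : V * option V * option V) := (p.1.1, odflt u p.1.2, odflt u p.2).
  exists u, v, w, (map c ps); split=> //; first by rewrite size_map.
    elim: ps ps0 psP {lek szps psU} => [|[[s [e|]] [f|]] ps IH] //= ps0 /andP[pP psP];
    by rewrite IH // andbT.
  suff -> : flatten (map cherry_vertices (map c ps)) = flatten (map partial_vertices ps) by [].
  elim: ps ps0 {lek szps psU psP} => [|[[s [e|]] [f|]] ps IH] //= ps0.
  by rewrite IH.
move=> ps_gt0.
have /hasP[p p_ps p_hole] : has (fun p => 0 < holes p) ps.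
  apply: contraTT ps_gt0 => /hasPn pss0; rewrite -leqNgt leqn0.
  elim: ps pss0 {lek szps psP psU} => [|p ps IH] //= pss0.
  rewrite addn_eq0 IH ?andbT; last by move=> q qps; rewrite pss0 ?inE ?qps ?orbT.
  by rewrite -leqn0 leqNgt pss0 ?mem_head.
have [ps1 [ps2 Eps]] : exists ps1 ps2, ps = ps1 ++ p :: ps2.
  by case/splitPr: p_ps => ps1 ps2; exists ps1, ps2.
have szL := size_partial_vertices ps.
set L := [:: u, v, w & _] in psU.
(* A hole remains, so L has at most 3 * t + 2 entries; two of them, the ends of the rich
   pair, are excluded from its codegree anyway, which leaves room for a new vertex. *)
have szL' : size L <= 3 * t + 2 by rewrite /L /=; lia.
have pL : p.1.1 \in flatten (map partial_vertices ps).
  by apply/flatten_mapP; exists p; rewrite ?mem_head.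
have Lp : p.1.1 \in L by rewrite !inE pL !orbT.
have Lu : u \in L by rewrite mem_head.
have Lv : v \in L by rewrite !inE eqxx orbT.
have up : u != p.1.1.
  have := psU; rewrite /L cons_uniq => /andP[+ _]; apply: contraNneq => ->.
  by rewrite !inE pL !orbT.
have vp : v != p.1.1.
  have := psU; rewrite /L 2!cons_uniq => /and3P[_ + _]; apply: contraNneq => ->.
  by rewrite !inE pL !orbT.
have pick x : x \in L -> x != p.1.1 -> rich x p.1.1 ->
    exists2 e, h x p.1.1 e & e \notin L.
  move=> xL xp xr; have szpx : size (rem p.1.1 (rem x L)) <= 3 * t.
    rewrite size_rem; last by rewrite mem_rem_uniq // inE /= eq_sym xp Lp.
    by rewrite size_rem // -!subn1 -subnDA leq_subLR addnC.
  have [|e] := @ex_notin_seq _ (nbr x p.1.1) (rem p.1.1 (rem x L)).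
    exact: leq_ltn_trans xr.
  rewrite in_nbr => he; move=> eL; exists e => //; move: eL.
  rewrite mem_rem_uniq ?rem_uniq // inE mem_rem_uniq // !inE.
  by rewrite eq_sym (adj_neq23 he) eq_sym (adj_neq13 he).
have fill p' x : perm_eq (partial_vertices p') (x :: partial_vertices p) -> holes p' < holes p ->
    partial_cherry u v p' -> x \notin L -> has_book.
  move=> p'P p'h p'c xL; apply: (IHk (ps1 ++ p' :: ps2)) => //.
  - rewrite ltnS in lek; apply: leq_trans lek.
    by rewrite Eps !map_cat !sumn_cat /= ltn_add2l ltn_add2r.
  - by rewrite -szps Eps !size_cat.
  - by move: psP; rewrite Eps !all_cat /= p'c; case/and3P=> -> _ ->.
  have <- : uniq (x :: L) = uniq [:: u, v, w & flatten (map partial_vertices (ps1 ++ p' :: ps2))].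
    rewrite /L Eps !map_cat !flatten_cat !map_cons; apply: perm_uniq.
    rewrite (perm_catCA [:: x] [:: u; v; w]) /= !perm_cons -cat1s.
    rewrite (perm_catCA [:: x]) perm_cat2l perm_sym.
    by rewrite -(perm_cat2r (flatten (map partial_vertices ps2))) in p'P.
  by rewrite cons_uniq xL psU.
have pP := allP psP _ p_ps; move: {Eps} fill => fill.
case: p => [[s [e|]] [f|]] in p_ps p_hole pL Lp up vp pick fill pP *;
  have /andP[/= pu pv] := pP; first by [].
- have [//|f hf fL] := pick v Lv vp; apply: (fill (s, Some e, Some f) f) => //=.
  + by rewrite (perm_catC [:: s; e] [:: f]).
  + by rewrite /partial_cherry /= pu hf.
- have [//|e he eL] := pick u Lu up; apply: (fill (s, Some e, Some f) e) => //=.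
  + by rewrite (perm_catCA [:: s] [:: e] [:: f]).
  + by rewrite /partial_cherry /= pv he.
have [//|e he eL] := pick u Lu up; apply: (fill (s, Some e, None) e) => //=.
+ by rewrite (perm_catC [:: s] [:: e]).
+ by rewrite /partial_cherry /= pv he.
Qed.

End Cherries.

(** * Rich neighbours and cherries around a core *)

Section BookFree.

Variables (V : finType) (h : triple_system V) (t : nat).
Hypothesis no_book : ~ has_book h t.

Local Notation N := (nbr h).
Local Notation d := (codeg h).
Local Notation rich := (rich h t).

Definition rich_nbrs x := [set y | rich x y].
Local Notation R := rich_nbrs.

(** [t] common rich neighbours of [u] and [v] would be the spines of a book with core [u v],
all of whose sides are rich pairs. *)
Lemma card_common_rich_without u v w :
  h u v w -> #|(R u :&: R v) :\ w| < t.
Proof.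
move=> huvw; rewrite ltnNge; apply/negP => le_t; apply: no_book.
set A := _ :\ w in le_t; pose s := take t (enum A).
have sA x : x \in s -> [/\ x != w, rich u x & rich v x].
  by move/mem_take; rewrite mem_enum !inE => /and3P[].
apply: (@complete_book _ h t u v w [seq (x, None, None) | x <- s]) => //.
- by rewrite size_map size_takel // -cardE.
- by apply/allP => p /mapP[x /sA[_ ru rv] ->]; rewrite /partial_cherry /= ru.
rewrite -map_comp (eq_map (g := fun x => [:: x])) // flatten_map1 map_id.
rewrite /= !inE take_uniq ?enum_uniq // andbT !negb_or.
rewrite (adj_neq12 huvw) (adj_neq13 huvw) (adj_neq23 huvw) /=.
apply/and3P; split; apply/negP => /sA[].
- by move=> _ /rich_neq; rewrite eqxx.
- by move=> _ _ /rich_neq; rewrite eqxx.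
- by rewrite eqxx.
Qed.

Lemma card_common_rich u v : 0 < d u v -> #|R u :&: R v| <= t.
Proof.
case/card_gt0P => w; rewrite inE => /card_common_rich_without.
by rewrite [X in _ -> X <= _](cardsD1 w); lia.
Qed.

(** Removing a vertex [w] of [N u v] leaves fewer than [t] common rich neighbours, so when
there are [t] of them every such [w] is itself one. *)
Lemma nbr_sub_common_rich u v :
  t <= #|R u :&: R v| -> N u v \subset R u :&: R v.
Proof.
move=> le_t; apply/subsetP => w; rewrite inE => /card_common_rich_without.
by move: le_t; rewrite (cardsD1 w); case: (w \in _) => //; lia.
Qed.

(** The candidate spines [b] whose cherry would reuse a vertex of [C], when [e b] is the third
vertex on one side. *)
Definition hit (X : {set V}) (e : V -> V) (C : seq V) :=
  [set b in X | (b \in C) || (e b \in C)].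

Lemma card_hit (X : {set V}) (e : V -> V) m (C : seq V) :
  (forall y, #|[set b in X | (b == y) || (e b == y)]| <= m) ->
  #|hit X e C| <= size C * m.
Proof.
move=> le_m; elim: C => [|y C IH].
  by rewrite /= leqn0 cards_eq0; apply/eqP/setP => b; rewrite !inE andbF.
rewrite mulSn; apply: leq_trans (leq_add (le_m y) IH).
apply: leq_trans (leq_card_setU _ _); apply: subset_leq_card.
by apply/subsetP => b; rewrite !inE => /andP[->]; rewrite /= orbACA.
Qed.

Lemma disjoint_pairs (X : {set V}) (e : V -> V) m k :
  (forall y, #|[set b in X | (b == y) || (e b == y)]| <= m) ->
  (forall b, b \in X -> b != e b) -> 2 * k * m < #|X| + (k == 0) ->
  exists bs, [/\ size bs = k, {subset bs <= X} & uniq (flatten [seq [:: b; e b] | b <- bs])].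
Proof.
move=> le_m neq; elim: k => [|k IHk] lek; first by exists [::].
have [|bs [szbs bsX bsU]] := IHk; first by case: (k) lek => [|l] /=; lia.
set C := flatten _ in bsU.
have szC : size C = 2 * k.
  by rewrite -szbs /C; elim: (bs) => //= b l ->; lia.
have [b bX bC] : exists2 b, b \in X & b \notin hit X e C.
  apply/subsetPn/negP => /subset_leq_card; apply/negP; rewrite -ltnNge.
  by apply: leq_ltn_trans (card_hit C le_m) _; rewrite szC; lia.
exists (b :: bs); split=> //=; first by rewrite szbs.
  by move=> y; rewrite inE => /predU1P[->|/bsX].
by move: bC; rewrite !inE bX /= negb_or => /andP[bC ebC]; rewrite negb_or neq // bC ebC.
Qed.

Lemma perm_cherries_zip (e : V -> V) (bs fs : seq V) : size bs = size fs ->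
  perm_eq (flatten (map (@cherry_vertices V) [seq (p.1, e p.1, p.2) | p <- zip bs fs]))
          (flatten [seq [:: b; e b] | b <- bs] ++ fs).
Proof.
elim: bs fs => [|b bs IH] [|f fs] //= [/IH bsfs].
by rewrite !perm_cons perm_sym (perm_catCA _ [:: f] fs) perm_cons perm_sym.
Qed.

(** Greedy choice of cherries with core [a c]: the triple [a b (e b)] is prescribed, and
there are [t] options for the third vertex of [c b]. Since no vertex is blocked by many [b],
the supply of disjoint pairs [b, e b] is large. If every remaining option is already used by the
cherries found so far, a system of distinct representatives among the options replaces them all. *)
Lemma card_cherry_spines a c w (X : {set V}) (e : V -> V) m : h a c w ->
  (forall b, b \in X -> [/\ h a b (e b), b \notin [:: c; w] & e b \notin [:: c; w]]) ->
  (forall b, b \in X -> t <= #|N c b :\: [set a; w; e b]|) ->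
  (forall y, #|[set b in X | (b == y) || (e b == y)]| <= m) ->
  #|X| <= 5 * t * m.
Proof.
move=> hacw XP Xt le_m; rewrite leqNgt; apply/negP => ltX; apply: no_book.
suff [cs [szcs csP csU]] : exists cs, [/\ size cs = t, all (cherry h a c) cs &
    uniq [:: a, c, w & flatten (map (@cherry_vertices V) cs)]].
  by exists a, c, w, cs.
elim: {-2}t (leqnn t) => [_|k IHk ltk].
  exists [::]; rewrite /= !inE !negb_or (adj_neq12 hacw) (adj_neq13 hacw).
  by rewrite (adj_neq23 hacw).
have [cs [szcs csP csU]] := IHk (ltnW ltk).
set C := flatten _ in csU.
have szC : size C = 3 * k by rewrite -szcs /C; elim: (cs) => //= b l ->; lia.
pose X' := X :\: hit X e C.
have X'X b : b \in X' -> b \in X by rewrite inE => /andP[].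
have ltX' : 2 * t * m < #|X'|.
  have := card_hit C le_m; have := cardsID (hit X e C) X.
  have := subset_leq_card (subsetIr X (hit X e C)).
  rewrite -/X' szC; nia.
(* Candidates clear of the k cherries found so far; t of them can be taken disjoint. *)
have [|||bs [szbs bsX' bsU]] := @disjoint_pairs X' e m t.
- move=> y; apply: leq_trans (le_m y); apply: subset_leq_card.
  by apply/subsetP => b; rewrite !inE => /andP[/andP[_ ->]].
- by move=> b /X'X /XP[/adj_neq23].
- by apply: leq_trans ltX' _; rewrite leq_addr.
have bsP b : b \in bs -> [/\ b \in X, b \notin C & e b \notin C].
  by move=> /bsX'; rewrite !inE => /andP[+ bX]; rewrite bX /= negb_or => /andP[].
pose F b := N c b :\: [set a; w; e b].
have [/hasP[b b_bs /subsetPn[f fF fC]]|/hasPn FC] :=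
    boolP (has (fun b => ~~ (F b \subset C)) bs).
  have [bX bC ebC] := bsP _ b_bs; have [hb bcw ecw] := XP b bX.
  exists ((b, e b, f) :: cs); split; first by rewrite /= szcs.
    by move: fF; rewrite /= csP andbT /cherry /= hb !inE => /andP[].
  move: fF fC; rewrite !inE !negb_or => /andP[/andP[/andP[fa fw] fe] hcf] fC.
  move: bcw ecw; rewrite !inE !negb_or => /andP[bc bw] /andP[ec ew].
  move: csU; rewrite -/C /= !inE !negb_or -!andbA /=.
  move=> /and5P[-> -> -> -> /and3P[-> -> ->]]; rewrite !andbT fC bC ebC /=.
  rewrite (adj_neq12 hb) (adj_neq13 hb) (adj_neq23 hb) (adj_neq13 hcf) (adj_neq23 hcf).
  by rewrite ![_ == f]eq_sym fa fw fe ![_ == b]eq_sym ![_ == e b]eq_sym bc bw ec ew.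
(* All the options lie inside C, so they avoid the new spines and side vertices: distinct
   representatives give t fresh cherries at once, and the old ones are thrown away. *)
have [|fs [szfs fsU fsF]] := @distinct_representatives V (map F bs).
  by move=> A /mapP[b /bsP[/Xt le_t _ _] ->]; rewrite size_map szbs.
have {}szfs : size bs = size fs by rewrite szfs size_map.
set cs' := [seq (p.1, e p.1, p.2) | p <- zip bs fs].
have szcs' : size cs' = t by rewrite size_map size_zip -szfs szbs minnn.
have fsP f : f \in fs -> [/\ f \in C, f != a, f != c & f != w].
  have FP b f' : b \in bs -> f' \in F b -> [/\ f' \in C, f' != a, f' != c & f' != w].
    move=> b_bs f'F; have := FC b b_bs; rewrite negbK => /subsetP/(_ f' f'F) f'C.
    move: f'F; rewrite !inE !negb_or => /andP[/andP[/andP[-> ->] _] hcf]; split=> //.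
    by rewrite eq_sym (adj_neq13 hcf).
  elim: (bs) (fs) szfs FP fsF => [|b l IH] [|g l'] //=.
  case=> szl FP.
  case/andP => gF lF; rewrite inE => /predU1P[->|]; first by apply: FP gF; rewrite mem_head.
  by apply: IH => // b' f' b'l; apply: FP; rewrite inE b'l orbT.
have bs_pairs y : y \in flatten [seq [:: b; e b] | b <- bs] ->
    [/\ y \notin C, y != a, y != c & y != w].
  case/flatten_mapP => b /bsP[/XP[hb bcw ecw] bC ebC].
  move: bcw ecw; rewrite !inE !negb_or => /andP[bc bw] /andP[ec ew].
  by case/orP => /eqP->; rewrite ?bC ?ebC 1?eq_sym ?(adj_neq12 hb) ?(adj_neq13 hb).
have hcs' : all (cherry h a c) cs'.
  rewrite /cs'; elim: (bs) (fs) szfs fsF bsP => [|b l IH] [|g l'] //= [szl].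
  case/andP => gF lF lP; rewrite IH ?andbT //; last first.
    by move=> b' b'l; apply: lP; rewrite inE b'l orbT.
  have [/XP[hb _ _] _ _] := lP b (mem_head _ _).
  by move: gF; rewrite /cherry /= hb !inE => /andP[].
exists (take k.+1 cs'); split.
- by rewrite size_takel // szcs'.
- by apply/allP => p /mem_take; apply: (allP hcs').
have unc : uniq [:: a, c, w & flatten (map (@cherry_vertices V) cs')].
  have := perm_cherries_zip e szfs; rewrite -(perm_cat2l [:: a; c; w]).
  move/perm_uniq => ->; rewrite cat_uniq [uniq (_ ++ fs)]cat_uniq bsU fsU.
  rewrite /= !inE negb_or (adj_neq12 hacw) (adj_neq13 hacw) (adj_neq23 hacw) /= andbT.
  apply/andP; split; last first.
    by apply/hasPn => f /fsP[fC _ _ _]; apply/negP => /bs_pairs[]; rewrite fC.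
  apply/hasPn => y; rewrite mem_cat !inE => /orP[/bs_pairs|/fsP] [_ /negbTE -> /negbTE -> /negbTE ->] //.
rewrite -[cs'](cat_take_drop k.+1) map_cat flatten_cat in unc.
apply: subseq_uniq unc; rewrite -!cat_cons; exact: prefix_subseq.
Qed.

(** Spines [b] that admit a cherry with core [a c] and base [w] of a robust kind: the triple
[a b w'] comes from a pair [a w'] of small codegree, so it serves few [b], and there are [t]
options on the side of [c]. *)
Definition busy_spines a c w m :=
  [set b | [exists w', [&& h a b w', d a w' < m & t <= #|N c b :\: [set w; w']|]]].

Lemma card_busy_spines a c w m : 0 < t -> 0 < m -> h a c w ->
  #|busy_spines a c w m| <= d a c + m + 5 * t * m.
Proof.
move=> t_gt0 m_gt0 hacw; rewrite /busy_spines; set B := [set b | _].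
pose ok b w' := [&& h a b w', d a w' < m & t <= #|N c b :\: [set w; w']|].
pose e b := odflt b [pick w' | ok b w'].
have eP b : b \in B -> ok b (e b).
  by rewrite inE /e => /existsP[w' w'P]; case: pickP => [//|/(_ w')]; rewrite /ok w'P.
(* Every b with e b = y lies in N a y, whose size is less than m. *)
have fibre y : #|[set b in B | e b == y]| <= m.-1.
  have [->|[b]] := set_0Vmem [set b in B | e b == y]; first by rewrite cards0.
  case/setIdP => /eP/and3P[_ lt_m _] /eqP eb; rewrite eb in lt_m.
  rewrite -ltnS prednK //; apply: leq_ltn_trans lt_m; apply: subset_leq_card.
  apply/subsetP => b' /setIdP[/eP/and3P[hb' _ _] /eqP eb'].
  by rewrite in_nbr adjA -eb'.
pose X := B :\: (N a c :|: [set b in B | e b == w]).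
have XP b : b \in X -> [/\ ok b (e b), ~~ h a c b & e b != w].
  case/setDP => bB; rewrite in_setU negb_or in_nbr => /andP[-> ebw].
  split=> //; first exact: eP.
  by apply: contraNneq ebw => ebw; apply/setIdP; rewrite ebw.
have leX : #|X| <= 5 * t * m.
  apply: (@card_cherry_spines a c w X e m) => //.
  - move=> b /XP[/and3P[hb _ leb] hacb ebw]; split=> //.
    + rewrite !inE; apply/norP; split; last by apply: contraNneq hacb => ->.
      by apply: contraTneq leb => ->; rewrite nbr_id set0D cards0 -ltnNge.
    + by rewrite !inE negb_or ebw andbT; apply: contraNneq hacb => ebc; rewrite adjA -ebc.
  - move=> b /XP[/and3P[_ _ leb] hacb _]; apply: leq_trans leb _; apply: subset_leq_card.
    apply/subsetP => y; rewrite !inE !negb_or => /andP[/andP[-> ->] hcb]; rewrite hcb !andbT.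
    by apply: contraNneq hacb => ya; rewrite adjR -ya.
  move=> y; have le_m : 1 + #|[set b in B | e b == y]| <= m by have := fibre y; lia.
  apply: leq_trans le_m; rewrite -(cards1 y); apply: leq_trans (leq_card_setU _ _).
  apply: subset_leq_card; apply/subsetP => b /setIdP[/setDP[bB _] /orP[by_|by_]].
    by rewrite in_setU in_set1 by_.
  by rewrite in_setU; apply/orP; right; apply/setIdP.
rewrite -(cardsID (N a c :|: [set b in B | e b == w]) B) leq_add //.
apply: leq_trans (subset_leq_card (subsetIr _ _)) _.
apply: leq_trans (leq_card_setU _ _) _; rewrite leq_add //.
exact: leq_trans (fibre w) (leq_pred m).
Qed.

End BookFree.

(** * Matchings in a link *)

Definition pair_vertices (V : Type) (p : V * V) := [:: p.1; p.2].

(** Augmentation: take two elements of [A] outside a matching of fewer than [q] edges. If all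
their neighbours are matched, their [2 * q] edges into the matching force an edge of it to be
replaced by two. *)
Lemma covering_matching (V : finType) (g : rel V) (A : {set V}) q :
  irreflexive g -> (forall v, v \in A -> q <= #|[set w | g v w]|) -> 2 * q <= #|A| ->
  exists M : seq (V * V), [/\ size M = q, all (fun p => (p.1 \in A) && g p.1 p.2) M &
    uniq (flatten (map (@pair_vertices V) M))].
Proof.
move=> g0 Aq leA; elim: {-2}q (leqnn q) => [_|k IHk ltk]; first by exists [::].
have [M [szM MP MU]] := IHk (ltnW ltk); set C := flatten _ in MU.
have szC : size C = 2 * k by rewrite -szM /C; elim: (M) => //= p l ->; lia.
have [a1 a1A a1C] : exists2 a, a \in A & a \notin C by apply: ex_notin_seq; lia.
have [a2 a2A] : exists2 a, a \in A & a \notin a1 :: C by apply: ex_notin_seq => /=; lia.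
rewrite inE negb_or => /andP[a21 a2C].
have [/existsP[a /existsP[b /and4P[aA aC gab bC]]]|] :=
    boolP [exists a, [exists b, [&& a \in A, a \notin C, g a b & b \notin C]]].
  exists ((a, b) :: M); split=> //=; first by rewrite szM.
    by rewrite aA gab.
  by rewrite inE negb_or aC bC; case: eqP gab => // ->; rewrite g0.
move/existsPn => noext.
(* No edge extends M, so all neighbours of a1 and a2 lie in C, and counting over the edges
   of M shows that one of them can be rerouted through both a1 and a2. *)
have nbC a : a \in A -> a \notin C -> #|[set w | g a w]| <= count (g a) C.
  move=> aA aC; rewrite -size_filter; apply: leq_trans (card_size _); apply: subset_leq_card.
  apply/subsetP => b; rewrite inE mem_filter => gab; rewrite gab /=.
  by have /existsPn/(_ b) := noext a; rewrite aA aC gab /= negbK.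
have /hasP[p pM pP] : has (fun p => g a1 p.1 && g a2 p.2 || g a2 p.1 && g a1 p.2) M.
  apply: contraLR ltk => /hasPn noaug; rewrite -leqNgt.
  have : count (g a1) C + count (g a2) C <= 2 * k.
    rewrite -szM /C; elim: (M) noaug => //= p l IHl noaug.
    have /IHl : forall x, x \in l -> ~~ (g a1 x.1 && g a2 x.2 || g a2 x.1 && g a1 x.2).
      by move=> x xl; rewrite noaug // inE xl orbT.
    have := noaug p (mem_head _ _); move: (count _ _) (count _ _) (size l) => i j n.
    by case: (g a1 p.1) (g a1 p.2) (g a2 p.1) (g a2 p.2) => [] [] [] [] //= _; clear; lia.
  by have := nbC a1 a1A a1C; have := nbC a2 a2A a2C; have := Aq a1 a1A; have := Aq a2 a2A; lia.
have [M1 [M2 EM]] : exists M1 M2, M = M1 ++ p :: M2.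
  by case/splitPr: pM => M1 M2; exists M1, M2.
wlog {pP} /andP[g1 g2] : a1 a2 a1A a2A a1C a2C a21 / g a1 p.1 && g a2 p.2.
  move=> W; case/orP: pP => pP; first exact: (W a1 a2).
  by apply: (W a2 a1); rewrite // eq_sym.
exists ((a1, p.1) :: (a2, p.2) :: M1 ++ M2); split.
- by move: szM; rewrite EM /= !size_cat /=; lia.
- by move: MP; rewrite EM /= !all_cat /= a1A a2A g1 g2 => /and3P[-> _ ->].
have : uniq [:: a1, a2 & C] by rewrite /= inE negb_or eq_sym a21 a1C a2C.
have EF : flatten (map (@pair_vertices V) (M1 ++ p :: M2)) = flatten (map (@pair_vertices V) M1) ++
  [:: p.1, p.2 & flatten (map (@pair_vertices V) M2)] by rewrite map_cat flatten_cat.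
have EF' : flatten (map (@pair_vertices V) [:: (a1, p.1), (a2, p.2) & M1 ++ M2]) =
  [:: a1, p.1, a2, p.2 & flatten (map (@pair_vertices V) M1) ++ flatten (map (@pair_vertices V) M2)].
  by rewrite /= map_cat flatten_cat.
rewrite EF' /C EM EF; move: (flatten _) (flatten _) => F1 F2.
congr is_true; apply: perm_uniq; apply/permP => x; rewrite /= !count_cat /=.
move: (count _ _) (count _ _) (nat_of_bool (x a1)) (nat_of_bool (x a2)).
by move: (nat_of_bool (x p.1)) (nat_of_bool (x p.2)); clear; lia.
Qed.

Section Spider.

Variables (V : finType) (h : triple_system V) (t : nat).
Hypothesis no_book : ~ has_book h t.

Local Notation N := (nbr h).
Local Notation d := (codeg h).
Local Notation rich := (rich h t).
Local Notation R := (rich_nbrs h t).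

Definition rich_ends x y := [set w in N x y | rich x w && rich y w].

Lemma card_rich_ends x y : #|rich_ends x y| <= t.
Proof.
have [->|[w wK]] := set_0Vmem (rich_ends x y); first by rewrite cards0.
apply: leq_trans (_ : #|R x :&: R y| <= t).
  by apply: subset_leq_card; apply/subsetP => z; rewrite !inE => /andP[_ /andP[-> ->]].
apply: (card_common_rich no_book); apply/card_gt0P; exists w.
by move: wK; rewrite !inE => /andP[].
Qed.

(** A book with core [x u]: the spines in [rich_ends x u] have two rich sides. The vertices [w]
counted here have a rich pair with [u], and more than [t] triples with [x], so a matching in the
link of [x] provides the missing spines together with their sides at [x]; the side at [u] is rich,
and one more such [w] closes the hyperedge [x u w]. *)
Lemma card_high_apex x u :
  #|[set w in N x u | [&& rich u w, ~~ rich x w & t < d x w]]| <= 2 * (t - #|rich_ends x u|).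
Proof.
set A := [set w in _ | _]; set K := rich_ends x u; set q := t - #|K|.
rewrite leqNgt; apply/negP => ltA; apply: no_book.
have AP w : w \in A -> [/\ h x u w, rich u w, ~~ rich x w & t < d x w].
  by rewrite !inE => /andP[-> /and3P[-> -> ->]].
pose g v e := [&& h x v e, e \notin K & e != u].
have [||| M [szM MP MU]] := @covering_matching V g A q.
- by move=> v; rewrite /g; apply/negP => /and3P[/adj_neq23]; rewrite eqxx.
- move=> v /AP[hv _ _ ltv].
  have sub : N x v \subset [set w | g v w] :|: (u |: K).
    apply/subsetP => e; rewrite in_nbr in_setU in_setU1 in_set /g => ->.
    by case: (e == u); case: (e \in K).
  have le1 : d x v <= #|[set w | g v w]| + #|u |: K|.
    exact: leq_trans (subset_leq_card sub) (leq_card_setU _ _).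
  have le2 : #|u |: K| <= 1 + #|K| by rewrite cardsU1 leq_add2r leq_b1.
  rewrite /q leq_subLR addnC -ltnS; apply: leq_trans ltv _.
  by apply: leq_trans le1 _; rewrite -addnS leq_add2l.
- exact: ltnW.
have [w wA wM] : exists2 w, w \in A & w \notin flatten (map (@pair_vertices V) M).
  apply: ex_notin_seq; apply: leq_trans ltA; rewrite ltnS -szM.
  by elim: (M) => //= p l; lia.
have MA p : p \in M -> [/\ p.1 \in A, h x p.1 p.2, p.2 \notin K & p.2 != u].
  by move/(allP MP)/andP => [-> /and3P[-> -> ->]].
have [huw ruw _ _] := AP _ wA.
pose ps : seq (V * option V * option V) := [seq (s, None, None) | s <- enum K] ++ [seq (p.1, Some p.2, None) | p <- M].
have EF : flatten (map (@partial_vertices V) ps) = enum K ++ flatten (map (@pair_vertices V) M).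
  rewrite map_cat flatten_cat -!map_comp; congr (_ ++ flatten _).
  by rewrite (eq_map (g := fun x => [:: x])) // flatten_map1 map_id.
apply: (@complete_book _ h t x u w ps) => //.
- by rewrite size_cat !size_map szM -cardE subnKC // card_rich_ends.
- rewrite all_cat; apply/andP; split; apply/allP => p /mapP[z].
    by rewrite mem_enum !inE => /andP[_ /andP[r1 r2]] ->; rewrite /partial_cherry /= r1.
  by move=> /MA[/AP[_ r _ _] hz _ _] ->; rewrite /partial_cherry /= hz.
rewrite EF -[_ :: _]/([:: x; u; w] ++ _) !cat_uniq enum_uniq MU /=.
rewrite !inE negb_or (adj_neq12 huw) (adj_neq13 huw) (adj_neq23 huw) /= andbT.
have KP s : s \in enum K -> [/\ h x u s, rich x s & rich u s].
  by rewrite mem_enum !inE => /andP[-> /andP[]].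
have Mv y : y \in flatten (map (@pair_vertices V) M) -> [/\ y != x, y != u & y \notin enum K].
  rewrite mem_enum; case/flatten_mapP => p /MA[/AP[hp _ rp _] hp2 p2K p2u].
  rewrite in_cons mem_seq1 => /orP[]/eqP->.
    rewrite eq_sym (adj_neq12 hp2) eq_sym (adj_neq23 hp); split=> //.
    by rewrite !inE negb_and (negbTE rp) orbT.
  by rewrite eq_sym (adj_neq13 hp2).
apply/andP; split; last by apply/hasPn => y /Mv[].
apply/hasPn => y; rewrite mem_cat !inE !negb_or => /orP[/KP[hy rx ru]|yM].
  rewrite eq_sym (adj_neq13 hy) eq_sym (adj_neq23 hy) /=.
  by apply: contraTneq rx => ->; have [_ _ ->] := AP _ wA.
by have [-> -> _] := Mv _ yM; apply: contraNneq wM => <-.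
Qed.

End Spider.

(** * Distributing the weight of a triple *)

(** Six units between two poor pairs, given whether each is low, that is, of codegree at
most [t]: a low pair can afford all six, as it receives them at most [t] times. *)
Definition split_share (l l' : bool) := if l == l' then 3 else if l then 6 else 0.

(** The part of the six units of a triple that goes to its pair [a], when [b] and [c] are the
other two pairs; each pair is described by whether it is rich and whether it is low. Rich pairs
have unbounded codegree and therefore receive something only from triples all of whose pairs are
rich, and at most [t] of these contain a given pair. *)
Definition share (a b c : bool * bool) :=
  match a.1, b.1, c.1 with
  | true, true, true => 2
  | true, _, _ => 0
  | false, true, true => 6
  | false, true, false => split_share a.2 c.2
  | false, false, true => split_share a.2 b.2
  | false, false, false => 2
  end.

Lemma share_sum a b c : share a b c + share b c a + share c a b = 6.
Proof. by case: a b c => [[] []] [[] []] [[] []]. Qed.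

Lemma shareC a b c : share a b c = share a c b.
Proof. by case: a b c => [[] []] [[] []] [[] []]. Qed.

Lemma sum_mem (V : finType) (A : {set V}) : \sum_x (x \in A) = #|A|.
Proof. by rewrite -sum1_card [RHS]big_mkcond; apply: eq_bigr => x _; case: (_ \in _). Qed.

Lemma sum_mem_le (V : finType) (N K A : {set V}) (f : V -> nat) a b :
  (forall w, w \in N -> f w <= a * (w \in K) + b * (w \in A)) ->
  \sum_(w in N) f w <= a * #|K| + b * #|A|.
Proof.
move=> le_f; apply: (@leq_trans (\sum_(w in N) (a * (w \in K) + b * (w \in A)))).
  exact: leq_sum.
rewrite big_mkcond /=; apply: (@leq_trans (\sum_w (a * (w \in K) + b * (w \in A)))).
  by apply: leq_sum => w _; case: ifP.
by rewrite big_split /= -!big_distrr /= !sum_mem.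
Qed.

Section Weights.

Variables (V : finType) (h : triple_system V) (t : nat).
Hypothesis no_book : ~ has_book h t.
Hypothesis t_gt0 : 0 < t.

Local Notation N := (nbr h).
Local Notation d := (codeg h).
Local Notation rich := (rich h t).
Local Notation R := (rich_nbrs h t).
Local Notation K := (rich_ends h t).

Definition status x y := (rich x y, d x y <= t).
Definition weight x y := \sum_(w in N x y) share (status x y) (status x w) (status y w).
Definition triples := \sum_x \sum_y d x y.

Lemma statusC x y : status x y = status y x.
Proof. by rewrite /status richC codegC. Qed.

Lemma weightC x y : weight x y = weight y x.
Proof.
rewrite /weight nbrC; apply: eq_bigr => w _.
by rewrite statusC shareC.
Qed.

Lemma sum_rotate (F : V -> V -> V -> nat) :
  \sum_x \sum_y \sum_(w in N x y) F x y w = \sum_x \sum_y \sum_(w in N x y) F y w x.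
Proof.
transitivity (\sum_x \sum_y \sum_w h x y w * F x y w).
  do 2!apply: eq_bigr => ? _; rewrite big_mkcond; apply: eq_bigr => w _.
  by rewrite in_nbr; case: (adj _ _ _ _); rewrite ?mul1n.
transitivity (\sum_x \sum_y \sum_w h y w x * F y w x).
  by rewrite [RHS]exchange_big; apply: eq_bigr => y _; rewrite [RHS]exchange_big.
apply: eq_bigr => x _; apply: eq_bigr => y _; rewrite [RHS]big_mkcond; apply: eq_bigr => w _.
by rewrite in_nbr -(adjR h x y w); case: (adj _ _ _ _); rewrite ?mul1n.
Qed.

(** Rotating the roles of the three vertices makes every triple contribute its six units. *)
Lemma sum_weight : \sum_x \sum_y weight x y = 2 * triples.
Proof.
pose F x y w := share (status x y) (status x w) (status y w).
have E1 : \sum_x \sum_y weight x y = \sum_x \sum_y \sum_(w in N x y) F y w x.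
  exact: sum_rotate.
have E2 : \sum_x \sum_y weight x y = \sum_x \sum_y \sum_(w in N x y) F w x y.
  by rewrite E1 sum_rotate.
set S := \sum_x _ in E1 E2 *; suff : S + S + S = 6 * triples by lia.
rewrite {2}E1 {2}E2 /triples big_distrr -!big_split; apply: eq_bigr => x _ /=.
rewrite -!big_split big_distrr; apply: eq_bigr => y _ /=.
rewrite -!big_split /codeg -sum1_card big_distrr; apply: eq_bigr => w _ /=.
rewrite muln1 -(share_sum (status x y) (status x w) (status y w)) /F.
by rewrite ![status w _]statusC (statusC y x); lia.
Qed.

Lemma weight_le_codeg x y : weight x y <= 6 * d x y.
Proof.
rewrite mulnC /codeg -sum_nat_const; apply: leq_sum => w _.
by case: (status x y) (status x w) (status y w) => [[] []] [[] []] [[] []].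
Qed.

(** With [t] rich ends there would be [t] common rich neighbours, containing all of [N x y]. *)
Lemma card_rich_ends_high x y : t < d x y -> #|K x y| < t.
Proof.
move=> ltd; rewrite ltnNge; apply/negP => le_t.
have sub : K x y \subset R x :&: R y.
  by apply/subsetP => w; rewrite !inE => /andP[_ /andP[-> ->]].
have := nbr_sub_common_rich no_book (leq_trans le_t (subset_leq_card sub)).
move/subset_leq_card; apply/negP; rewrite -ltnNge; apply: leq_ltn_trans (ltd).
by apply: (card_common_rich no_book); apply: leq_trans ltd.
Qed.

Lemma weight_high x y : ~~ rich x y -> t < d x y -> weight x y <= 3 * d x y + 3 * #|K x y|.
Proof.
move=> nr ltd; rewrite addnC; apply: sum_mem_le => w wN; rewrite wN muln1 !inE.
rewrite in_nbr in wN; rewrite wN /share /status (negbTE nr) (leqNgt (d x y)) ltd /=.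
by case: (rich x w) (rich y w) (d x w <= t) (d y w <= t) => [] [] [] [].
Qed.

Lemma weight_rich x y : rich x y -> weight x y <= 2 * t.
Proof.
move=> r; apply: (@leq_trans (2 * #|K x y| + 0 * #|K x y|)); last first.
  by rewrite addn0 leq_mul2l card_rich_ends.
apply: sum_mem_le => w wN; rewrite in_nbr in wN; rewrite !inE wN /share /status r /=.
by case: (rich x w) (rich y w) => [] [].
Qed.

(** The extreme case is a poor pair of codegree up to [3 * t], each triple giving it three
units and the fewer than [t] rich ends three more. *)
Lemma weight_max x y : weight x y + 3 <= 12 * t.
Proof.
have [r|nr] := boolP (rich x y); first by have := weight_rich r; lia.
have [ltd|led] := ltnP t (d x y); last by have := weight_le_codeg x y; lia.
have := weight_high nr ltd; have := card_rich_ends_high ltd.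
by move: nr; rewrite /rich -leqNgt; lia.
Qed.

Lemma weight_le_6t x y : d x y <= t.+1 -> weight x y <= 6 * t.
Proof.
move=> led; have [r|nr] := boolP (rich x y); first by have := weight_rich r; lia.
have [ltd|led'] := ltnP t (d x y); last by have := weight_le_codeg x y; lia.
by have := weight_high nr ltd; have := card_rich_ends_high ltd; lia.
Qed.

(** Only the rich ends give six units and only the vertices of [card_high_apex] give
three; the bound [2 * (t - k)] on the latter, with [k] rich ends, balances exactly to [6 * t]. *)
Lemma weight_captured x z : (forall w, h x z w -> rich z w) -> weight x z <= 6 * t.
Proof.
move=> capt; have [r|nr] := boolP (rich x z); first by have := weight_rich r; lia.
have [ltd|led'] := ltnP t (d x z); last by have := weight_le_codeg x z; lia.
have := card_high_apex no_book x z; set A := [set w in _ | _] => leA.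
apply: (@leq_trans (6 * #|K x z| + 3 * #|A|)); last first.
  by have := card_rich_ends no_book x z; lia.
apply: sum_mem_le => w; rewrite in_nbr => hw; have rzw := capt w hw.
rewrite !inE hw rzw /share /status (negbTE nr) (leqNgt (d x z)) ltd /= !andbT ltnNge.
by rewrite rzw; case: (rich x w) (d x w <= t) => [] [].
Qed.

(** The weights sum to [2 * triples h], and none of them exceeds [12 * t]. *)
Lemma triples_shadow : triples <= 6 * t * #|[set p : V * V | 0 < d p.1 p.2]|.
Proof.
rewrite -(leq_pmul2l (isT : 0 < 2)) -sum_weight pair_big /= mulnCA mulnA -[X in X * _]mulnA.
rewrite mulnC -sum_nat_const big_mkcond [leqRHS]big_mkcond /=; apply: leq_sum => p _.
rewrite inE; case: posnP => [d0|_]; last by have := weight_max p.1 p.2; lia.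
by have := weight_le_codeg p.1 p.2; rewrite d0; lia.
Qed.

End Weights.

(** * Heavy pairs cluster *)

Section Ratio.
Import Order.TTheory GRing.Theory Num.Theory.
Local Open Scope ring_scope.

Lemma ratio_sum (a b : rat) : 0 < a -> 0 < b -> 2 <= a / b + b / a.
Proof.
move=> a0 b0; rewrite addf_div ?lt0r_neq0 // ler_pdivlMr ?mulr_gt0 //.
rewrite -subr_ge0 [X in 0 <= X](_ : _ = (a - b) ^+ 2) ?sqr_ge0 //.
by rewrite sqrrB !expr2 mulr_natl (mulrC b a) addrAC.
Qed.

(** The bound is on the degrees of the neighbours of [v], not on that of [v] itself; it is
the inequality [a / b + b / a >= 2] that transfers it. *)
Lemma sum_degree_le_neighbour_bound (V : finType) (g : rel V) (M : V -> nat) :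
  symmetric g -> (forall x v, g x v -> (#|[set y | g x y]| <= M v)%N) ->
  (\sum_x #|[set y | g x y]| <= \sum_v M v)%N.
Proof.
move=> gC gM; pose dg x := #|[set y | g x y]|.
have dg_gt0 x v : g x v -> (0 < dg x)%N.
  by move=> gxv; apply/card_gt0P; exists v; rewrite inE.
have dgE x : dg x = (\sum_(y | g x y) 1)%N.
  by rewrite /dg -sum1_card; apply: eq_bigl => y; rewrite inE.
rewrite (eq_bigr (fun x => \sum_(y | g x y) 1)%N); last by move=> x _; apply: dgE.
rewrite -(ler_nat rat) !natr_sum.
(* S sums dg x / dg v over the oriented edges; it is symmetric, so S is at least the number
   of oriented edges, and each v contributes to it at most M v. *)
pose S : rat := \sum_v \sum_(x | g v x) (dg x)%:R / (dg v)%:R.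
have leS : S <= \sum_v (M v)%:R.
  apply: ler_sum => v _; have [d0|d_gt0] := posnP (dg v).
    rewrite d0 invr0; under eq_bigr do rewrite mulr0.
    by rewrite sumr_const mul0rn.
  rewrite -mulr_suml ler_pdivrMr ?ltr0n // -natr_sum -natrM ler_nat.
  rewrite dgE big_distrr /=; apply: leq_sum => x gvx; rewrite muln1.
  by apply: gM; rewrite gC.
have SC : S = \sum_v \sum_(x | g v x) (dg v)%:R / (dg x)%:R.
  rewrite /S (exchange_big_dep predT) //=; apply: eq_bigr => v _.
  by apply: eq_bigl => x; rewrite gC.
apply: le_trans leS; rewrite -(@ler_pM2l _ 2) //.
have -> : 2 * S = S + \sum_v \sum_(x | g v x) (dg v)%:R / (dg x)%:R.
  by rewrite -SC mulr_natl mulr2n.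
rewrite /S -big_split mulr_sumr; apply: ler_sum => v _ /=.
rewrite -big_split natr_sum mulr_sumr; apply: ler_sum => x gvx /=.
have xv : g x v by rewrite gC.
by rewrite mulr1 ratio_sum ?ltr0n ?(dg_gt0 _ _ gvx) ?(dg_gt0 _ _ xv).
Qed.

End Ratio.

Section Counting.

Variables (V : finType) (h : triple_system V) (t : nat).
Hypothesis no_book : ~ has_book h t.
Hypothesis t_gt0 : 0 < t.

Local Notation N := (nbr h).
Local Notation d := (codeg h).
Local Notation rich := (rich h t).
Local Notation wt := (weight h t).
Local Notation n := #|V|.

Definition heavy x y := 6 * t < wt x y.

Lemma heavyC x y : heavy x y = heavy y x.
Proof. by rewrite /heavy weightC. Qed.

Lemma heavy_codeg x y : heavy x y -> t.+1 < d x y.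
Proof. by rewrite ltnNge; apply: contraL => /(weight_le_6t no_book t_gt0); rewrite -leqNgt. Qed.

(** Otherwise all triples through the pair would be captured by rich pairs at one end. *)
Lemma heavy_poor x y : heavy x y -> exists2 w, h x y w & ~~ rich x w.
Proof.
rewrite heavyC => hxy; have [/existsP[w /andP[hw rw]]|/existsPn nw] :=
  boolP [exists w, h x y w && ~~ rich x w]; first by exists w.
move: hxy; rewrite /heavy ltnNge (weight_captured no_book t_gt0) // => w hw.
by have := nw w; rewrite adjC hw /= negbK.
Qed.

Definition spread := (3 * t).+1 + 5 * t * (3 * t).+1.

(** If [x v] and [x z] are heavy, a poor pair [v w'] of a triple [v x w'] and the codegree of
[x z], which exceeds [t + 1], make [x] a busy spine for the core [v z]. *)
Lemma card_heavy_both v z : 0 < d v z ->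
  #|[set x | heavy x v && heavy x z]| <= d v z + spread.
Proof.
case/card_gt0P => w; rewrite in_nbr => hvzw.
have := card_busy_spines no_book t_gt0 (ltn0Sn (3 * t)) hvzw; rewrite -addnA.
apply: leq_trans; apply: subset_leq_card; apply/subsetP => x; rewrite !inE => /andP[xv xz].
have [w' hw' rw'] : exists2 w', h v x w' & ~~ rich v w' by apply: heavy_poor; rewrite heavyC.
apply/existsP; exists w'; rewrite hw' ltnS leqNgt rw' /=.
have := heavy_codeg xz; rewrite codegC /codeg => ltd.
have := cardsID [set w; w'] (N z x); have := cards2 w w'.
have := subset_leq_card (subsetIr (N z x) [set w; w']).
move: (w != w') ltd; set a := #|_|; set b := #|_|; set c := #|_|; set e := #|_|.
by case; clear; lia.
Qed.

(** The number of [x] heavy with both ends of [v z] is at most [d v z] plus a constant, and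
the sum of the codegrees is [O(n ^ 2)]. *)
Lemma heavy_clustering :
  \sum_x \sum_(v | heavy x v) #|[set z | heavy x z && (0 < d v z)]|
    <= (6 * t + spread) * n ^ 2.
Proof.
apply: (@leq_trans (\sum_v \sum_z (d v z + spread))); last first.
  under eq_bigr do rewrite big_split sum_nat_const /=.
  rewrite big_split sum_nat_const /= mulnDl leq_add //; last by rewrite cardE; nia.
  apply: leq_trans (triples_shadow no_book t_gt0) _; rewrite leq_mul2l; apply/orP; right.
  by rewrite -mulnn -card_prod max_card.
under eq_bigr => x _.
  rewrite big_mkcond.
  under eq_bigr => v _ do rewrite -sum_mem.
  over.
rewrite exchange_big /=; apply: leq_sum => v _.
apply: (@leq_trans (\sum_x \sum_z (heavy x v && heavy x z && (0 < d v z)))).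
  apply: leq_sum => x _; case: (heavy x v); last by [].
  by apply: leq_sum => z _; rewrite inE.
rewrite exchange_big /=; apply: leq_sum => z _.
have [d0|d_gt0] := posnP (d v z).
  by rewrite big1 // => x _; rewrite andbF.
apply: leq_trans (card_heavy_both d_gt0); rewrite -sum_mem; apply: leq_sum => x _.
by rewrite inE andbT.
Qed.

End Counting.

(** * Almost all pairs have weight 6t *)

Lemma sum_predE (V : finType) (p : pred V) : \sum_x (p x : nat) = #|[set x | p x]|.
Proof. by rewrite -sum_mem; apply: eq_bigr => x _; rewrite inE. Qed.

Lemma sqr_le_falling n t : t < n -> n ^ 2 <= (n - t) * (n - t.+1) + (2 * t + 1) * n.
Proof.
move=> lt_tn; rewrite -{1 4}(subnKC lt_tn) -[n - t](subnKC (_ : 0 < n - t)) ?subn_gt0 //.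
rewrite -subnDA addn1; move: (n - t.+1) => k; rewrite -mulnn; nia.
Qed.

Section Density.

Variables (V : finType) (h : triple_system V) (t : nat).
Hypothesis no_book : ~ has_book h t.
Hypothesis t_gt0 : 0 < t.

Local Notation d := (codeg h).
Local Notation wt := (weight h t).
Local Notation heavy := (heavy h t).
Local Notation spread := (spread t).
Local Notation n := #|V|.

Definition heavy_pairs := \sum_x #|[set y | heavy x y]|.
Definition missing_pairs := \sum_x #|[set y | d x y == 0]|.
Definition bad_pairs := \sum_x #|[set y | wt x y != 6 * t]|.

(** Apart from few exceptions, a heavy pair [x v] is such that all but [L] of the heavy
neighbours of [x] form an empty pair with [v]; then the heavy degree of [x] is at most the number
of empty pairs at [v], plus [L]. *)
Lemma heavy_pairs_le L :
  L * heavy_pairs <= L * missing_pairs + n * L ^ 2 + 2 * (6 * t + spread) * n ^ 2.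
Proof.
pose c x v := #|[set z | heavy x z && (0 < d v z)]|.
pose g x v := [&& heavy x v, c x v <= L & c v x <= L].
have gC : symmetric g by move=> x v; rewrite /g heavyC; congr (_ && _); apply: andbC.
have gM x v : g x v -> #|[set y | g x y]| <= #|[set y | d v y == 0]| + L.
  case/and3P=> _ le_c _; apply: leq_trans (leq_add (leqnn _) le_c).
  apply: leq_trans (leq_card_setU _ _); apply: subset_leq_card; apply/subsetP => y.
  by rewrite !inE => /and3P[-> _ _]; case: posnP.
have le_g := sum_degree_le_neighbour_bound gC gM.
rewrite big_split sum_nat_const /= -/missing_pairs in le_g.
(* far counts the heavy pairs left out of g because of c x v; by symmetry it also counts
   those left out because of c v x. *)
pose far := \sum_x #|[set v | heavy x v && (L < c x v)]|.
have far_le : L * far <= (6 * t + spread) * n ^ 2.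
  apply: leq_trans (heavy_clustering no_book t_gt0); rewrite big_distrr; apply: leq_sum => x _.
  rewrite /= -sum_mem big_distrr [leqRHS]big_mkcond /=; apply: leq_sum => v _; rewrite inE.
  case: (heavy x v) => /=; last by rewrite muln0.
  by case: ltnP => ltc; rewrite ?muln0 ?muln1 // ltnW.
have farC : far = \sum_x #|[set v | heavy x v && (L < c v x)]|.
  rewrite /far; under eq_bigr do rewrite -sum_mem; rewrite exchange_big /=.
  apply: eq_bigr => x _; rewrite -sum_mem; apply: eq_bigr => v _.
  by rewrite !inE heavyC.
have : heavy_pairs <= \sum_x #|[set y | g x y]| + (far + far).
  rewrite {2}farC -!big_split; apply: leq_sum => x _.
  apply: leq_trans (leq_add (leqnn _) (leq_card_setU _ _)).
  apply: leq_trans (leq_card_setU _ _); apply: subset_leq_card; apply/subsetP => y.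
  by rewrite !inE /g !(leqNgt _ L) => -> /=; case: ltnP; case: ltnP.
set c1 := 6 * t + spread in far_le *.
move/(leq_mul (leqnn L)); rewrite !(mulnDr L) => /leq_trans; apply.
rewrite addnn -mul2n -[2 * c1 * n ^ 2]mulnA; apply: leq_add; last by rewrite leq_mul2l far_le.
by apply: leq_trans (leq_mul (leqnn L) le_g) _; rewrite mulnDr -mulnn mulnCA.
Qed.

(** A heavy pair exceeds [6 * t] by at most [6 * t - 3], while a pair in no triple falls
short by [6 * t]. *)
Lemma weight_balance :
  2 * triples h + 6 * t * missing_pairs + 3 * heavy_pairs <= 6 * t * n ^ 2 + 6 * t * heavy_pairs.
Proof.
have -> : 6 * t * n ^ 2 = \sum_(x : V) \sum_(y : V) 6 * t.
  by rewrite !sum_nat_const [RHS]mulnA mulnn mulnC.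
rewrite -(sum_weight h t_gt0) !big_distrr -!big_split; apply: leq_sum => x _ /=.
rewrite -!sum_mem !big_distrr -!big_split; apply: leq_sum => y _ /=; rewrite !inE.
have := weight_le_codeg h t x y; have := weight_max no_book t_gt0 x y.
by rewrite -[heavy x y]/(6 * t < wt x y); case: ltnP; case: eqP => [->|_] /=; lia.
Qed.

Lemma bad_pairs_le : bad_pairs + 2 * triples h <= 6 * t * n ^ 2 + 6 * t * heavy_pairs.
Proof.
have -> : 6 * t * n ^ 2 = \sum_(x : V) \sum_(y : V) 6 * t.
  by rewrite !sum_nat_const [RHS]mulnA mulnn mulnC.
rewrite -(sum_weight h t_gt0) !big_distrr -!big_split; apply: leq_sum => x _ /=.
rewrite -!sum_mem !big_distrr -!big_split; apply: leq_sum => y _ /=; rewrite !inE.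
have := weight_max no_book t_gt0 x y.
by rewrite -[heavy x y]/(6 * t < wt x y); case: eqP => /=; case: ltnP => /=; lia.
Qed.

End Density.

Lemma few_bad_pairs t Q : 0 < t -> exists n0, forall (V : finType) (h : triple_system V),
  n0 <= #|V| -> ~ has_book h t -> 3 * t * (#|V| - t) * (#|V| - t.+1) <= triples h ->
  Q * bad_pairs h t <= #|V| ^ 2.
Proof.
move=> t_gt0; have [->|Q_gt0] := posnP Q; first by exists 0.
pose c1 := 6 * t + spread t; pose X := 72 * t ^ 2 * c1; pose L := Q * X.
pose A := 18 * t * (2 * t + 1) * L + 36 * t ^ 2 * (2 * t + 1) * L + 36 * t ^ 2 * L ^ 2.
exists (A + t.+1) => V h le_n nb le_tr.
have H1 := heavy_pairs_le nb t_gt0 L.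
have H2 := weight_balance nb t_gt0.
have H3 := bad_pairs_le nb t_gt0.
have X_gt0 : 0 < X by rewrite /X !muln_gt0 t_gt0 /c1 addn_gt0 muln_gt0 t_gt0.
have L_gt0 : 0 < L by rewrite muln_gt0 Q_gt0.
move: H1 H2 H3 le_tr le_n; rewrite -/c1.
move: (heavy_pairs h t) (missing_pairs h) (bad_pairs h t) (triples h) #|V|.
move=> b m P tr n H1 H2 H3 le_tr le_n.
have {}le_tr : 3 * t * n ^ 2 <= tr + 3 * t * (2 * t + 1) * n.
  apply: leq_trans (leq_add le_tr (leqnn _)).
  rewrite -!mulnA -!mulnDr !leq_mul2l /=; apply/orP; right.
  by apply: sqr_le_falling; apply: leq_trans le_n; rewrite leq_addl.
have {}H2 : 6 * t * m + 3 * b <= 6 * t * (2 * t + 1) * n + 6 * t * b.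
  by move: H2 le_tr; clear; lia.
have {}H3 : P <= 6 * t * (2 * t + 1) * n + 6 * t * b by move: H3 le_tr; clear; lia.
set F := 6 * t * (2 * t + 1) * n in H2 H3; set a := 6 * t in H2 H3.
rewrite -addnA in H1; set E := n * L ^ 2 + _ in H1.
(* The heavy terms of H1 and H2 cancel up to the gain 3 * b of a heavy pair; H4 and H5
   bound b and P by lower-order terms plus a fraction of n ^ 2 of order 1 / L. *)
have H4 : 3 * (L * b) <= L * F + a * E.
  move: (leq_mul (leqnn L) H2) (leq_mul (leqnn a) H1).
  rewrite (mulnDr L (a * m)) (mulnDr L F) (mulnDr a (L * m)) (mulnCA L a m) (mulnCA L a b) (mulnCA L 3 b); clear; lia.
have H5 : 3 * (L * P) <= A * n + X * n ^ 2.
  have -> : A * n + X * n ^ 2 = 3 * (L * F) + a * (L * F + a * E).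
    by rewrite /F /a /A /X /E; ring.
  apply: (@leq_trans (3 * (L * F) + a * (3 * (L * b)))); last by rewrite leq_add2l leq_mul2l H4 orbT.
  by rewrite (mulnCA a) -mulnDr leq_mul2l /= (mulnCA a) -mulnDr leq_mul2l H3 orbT.
have le_An : A * n <= X * n ^ 2.
  rewrite -mulnn mulnA leq_mul2r; apply/orP; right; apply: leq_trans (leq_pmull n X_gt0).
  by apply: leq_trans le_n; rewrite leq_addr.
have EL : L = Q * X by [].
clearbody L; have L3_gt0 : 0 < 3 * L by rewrite muln_gt0.
rewrite -(leq_pmul2l L3_gt0) -!mulnA (mulnCA L Q P) (mulnCA 3 Q).
apply: leq_trans (leq_mul (leqnn Q) H5) _.
apply: (@leq_trans (Q * (X * n ^ 2 + X * n ^ 2))); first by rewrite leq_mul2l leq_add2r le_An orbT.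
by rewrite EL addnn -mul2n !mulnA [3 * Q]mulnC -!mulnA !leq_mul2l /= leq_mul2r !orbT.
Qed.

(** * Local structure around pairs of weight 6t *)

Section Balanced.

Variables (V : finType) (h : triple_system V) (t : nat).
Hypothesis no_book : ~ has_book h t.
Hypothesis t_gt0 : 0 < t.

Local Notation N := (nbr h).
Local Notation d := (codeg h).
Local Notation rich := (rich h t).
Local Notation R := (rich_nbrs h t).
Local Notation K := (rich_ends h t).
Local Notation wt := (weight h t).
Local Notation st := (status h t).

Definition good x y := wt x y == 6 * t.

Lemma goodC x y : good x y = good y x. Proof. by rewrite /good weightC. Qed.

Lemma good_poor x y : good x y -> ~~ rich x y.
Proof. by move/eqP => e; apply/negP => /(weight_rich no_book); rewrite e; lia. Qed.

Lemma good_codeg x y : good x y -> t <= d x y.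
Proof. by move/eqP => e; have := weight_le_codeg h t x y; rewrite e leq_mul2l. Qed.

Lemma good_nbr x y : good x y -> exists w, h x y w.
Proof.
by move/good_codeg/(leq_trans t_gt0)/card_gt0P => [w]; rewrite in_nbr; exists w.
Qed.

(** A pair with at most [t] triples reaches [6 * t] only if each of them gives it all six units. *)
Lemma good_low_share x y w :
  good x y -> d x y <= t -> h x y w -> share (st x y) (st x w) (st y w) = 6.
Proof.
move=> /eqP gxy led hw; apply/eqP; rewrite eqn_leq; apply/andP; split.
  by case: (st x y) (st x w) (st y w) => [[] []] [[] []] [[] []].
have : \sum_(v in N x y | v != w) share (st x y) (st x v) (st y v) <= 6 * (d x y).-1.
  rewrite /codeg (cardsD1 w) in_nbr hw add1n /= mulnC -sum_nat_const.
  rewrite (eq_bigl (mem (N x y :\ w))) => [|v]; last by rewrite !inE andbC.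
  by apply: leq_sum => v _; case: (st x y) (st x v) (st y v) => [[] []] [[] []] [[] []].
move: gxy; rewrite /weight (bigD1 w) ?in_nbr //=; move: (\sum_(_ in _ | _) _) => S.
have : 0 < d x y by apply/card_gt0P; exists w; rewrite in_nbr.
by move: (share _ _ _) led; clear -t_gt0; lia.
Qed.

(** Three units from each of [t] triples and three more for fewer than [t] rich ends stay
below [6 * t], so no triple can give nothing. *)
Lemma good_high_share x y w :
  good x y -> d x y = t.+1 -> h x y w -> share (st x y) (st x w) (st y w) != 0.
Proof.
move=> gxy dt hw; have nr := good_poor gxy; move: gxy => /eqP gxy; apply/eqP => sh0.
have ltd : t < d x y by rewrite dt.
have kt := card_rich_ends_high no_book ltd.
have wK : w \notin K x y.
  apply: contra_eqN sh0; rewrite !inE => /andP[_ /andP[r1 r2]].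
  by rewrite /share /status (negbTE nr) r1 r2.
have : \sum_(v in N x y | v != w) share (st x y) (st x v) (st y v) <= 3 * #|K x y| + 3 * #|N x y :\ w|.
  rewrite (eq_bigl (mem (N x y :\ w))) => [|v]; last by rewrite !inE andbC.
  apply: sum_mem_le => v vN; rewrite vN muln1 !inE; move: vN; rewrite !inE => /andP[_ hv].
  rewrite hv /share /status (negbTE nr) (leqNgt (d x y)) ltd /=.
  by case: (rich x v) (rich y v) (d x v <= t) (d y v <= t) => [] [] [] [].
move: gxy; rewrite /weight (bigD1 w) ?in_nbr //= sh0 add0n => ->.
have -> : #|N x y :\ w| = t by move: dt; rewrite /codeg (cardsD1 w) in_nbr hw => -[].
by move: kt t_gt0; clear; lia.
Qed.

Lemma card_setD2 (A : {set V}) x y : #|A| <= #|A :\: [set x; y]| + (x \in A) + (y \in A).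
Proof.
rewrite -(cardsID [set x; y] A) addnC -addnA leq_add2l.
apply: (@leq_trans #|[set z in [set x] | z \in A] :|: [set z in [set y] | z \in A]|).
  by apply: subset_leq_card; apply/subsetP => z; rewrite !inE => /andP[-> H]; rewrite !andbT.
apply: leq_trans (leq_card_setU _ _) _.
suff c1 z : #|[set u in [set z] | u \in A]| <= (z \in A) by rewrite leq_add.
case: (boolP (z \in A)) => zA.
  by rewrite /= -(cards1 z); apply: subset_leq_card; apply/subsetP => u; rewrite inE => /andP[].
rewrite /= leqn0 cards_eq0; apply/eqP/setP => u; rewrite !inE; apply/andP => -[/eqP->].
by rewrite (negbTE zA).
Qed.

(** This excludes that [b] or a poor third vertex [w] is a busy spine for the core [a c], and asks
that [c w] be good. *)
Definition aligned a b c := [forall w, (h a b w && ~~ rich a w) ==> (good c w &&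
  [forall w0, h a c w0 ==> (#|N c b :\: [set w0; w]| < t) && (#|N c w :\: [set w0; b]| < t)])].

Lemma alignedP a b c w : aligned a b c -> h a b w -> ~~ rich a w ->
  good c w /\ forall w0, h a c w0 -> #|N c b :\: [set w0; w]| < t /\ #|N c w :\: [set w0; b]| < t.
Proof.
move=> /forallP/(_ w) + hw rw; rewrite hw rw /= => /andP[-> /forallP al]; split=> // w0 hw0.
by have := al w0; rewrite hw0 => /andP[].
Qed.

(** Fewer than [t] elements of [N c b] lie outside [w0, w], for every [w0] in [N a c]. If
[w] is not in [N c b], then all these [w0] must be, and the two sets coincide. If it is, both
[c b] and [c w] have codegree at most [t + 1]; they share the triple [c b w], and good pairs of
such small codegree can only both be satisfied if both are high. *)
Lemma aligned_witness a b c w : good a c -> good c b -> aligned a b c ->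
  h a b w -> ~~ rich a w ->
  [/\ ~~ h c b w, N a c = N c b & d a c = t] \/
  [/\ h c b w, N c b :\ w = N a c & d c b = t.+1].
Proof.
move=> gac gcb al hw rw; have [gcw al'] := alignedP al hw rw.
have [w0 hw0] := good_nbr gac.
have [hcbw|nhcbw] := boolP (h c b w); last first.
  left; have sub : N a c \subset N c b /\ d c b <= t.
    have H v : h a c v -> (v \in N c b) /\ d c b <= t.
      move=> /al'[lt1 _]; have := card_setD2 (N c b) v w; rewrite [w \in _]in_nbr (negbTE nhcbw).
      rewrite addn0 -/(d c b); have := good_codeg gcb; case: (v \in N c b) => /=.
        by move: lt1; rewrite -/(d c b); clear; lia.
      by move: lt1; clear; lia.
    by split; [apply/subsetP => v; rewrite in_nbr => /H[] | have [] := H _ hw0].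
  have eN : N a c = N c b.
    by apply/eqP; rewrite eqEcard sub.1 (leq_trans sub.2) // good_codeg.
  split=> //; apply/eqP; rewrite eqn_leq (good_codeg gac) andbT.
  by rewrite /codeg eN sub.2.
right; have hcwb : h c w b by rewrite adjA.
have [lt1 lt2] := al' _ hw0.
have le1 : d c b <= t.+1.
  have := card_setD2 (N c b) w0 w; rewrite -/(d c b).
  by move: lt1; case: (w0 \in _) (w \in _) => [] [] /=; clear; lia.
have le2 : d c w <= t.+1.
  have := card_setD2 (N c w) w0 b; rewrite -/(d c w).
  by move: lt2; case: (w0 \in _) (b \in _) => [] [] /=; clear; lia.
have ncb := good_poor gcb; have ncw := good_poor gcw.
have dcb : d c b = t.+1.
  apply/eqP; rewrite eqn_leq le1 ltnNge; apply/negP => low1.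
  have := good_low_share gcb low1 hcbw; rewrite /share /status (negbTE ncb) (negbTE ncw) low1 /=.
  have [low2|high2] := leqP (d c w) t; first by case: ifP.
  have dcw : d c w = t.+1 by apply/eqP; rewrite eqn_leq le2 high2.
  have := good_high_share gcw dcw hcwb; rewrite /share /status (negbTE ncb) (negbTE ncw) low1 /=.
  by rewrite leqNgt high2 richC; case: ifP.
split=> //; apply/esym/eqP; rewrite eqEcard; apply/andP; split; last first.
  have := cardsD1 w (N c b); rewrite in_nbr hcbw -/(d c b) dcb add1n => -[<-].
  exact: good_codeg.
apply/subsetP => v; rewrite in_nbr => /al'[ltv _]; rewrite in_setD1.
have := card_setD2 (N c b) v w; rewrite -/(d c b) dcb.
have [vw|_] := eqVneq v w; last by move: ltv; case: (v \in _) (w \in _) => [] [] /=; clear; lia.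
move: dcb; rewrite /codeg (cardsD1 w) in_nbr hcbw add1n => -[eT].
by move: ltv; rewrite vw setUid eT ltnn.
Qed.

(** All six orders are required because each step of the local analysis renames the vertices. *)
Definition balanced a b c := [&& good a b, good a c, good b c,
  [&& aligned a b c, aligned a c b & aligned b a c] &
  [&& aligned b c a, aligned c a b & aligned c b a]].

Lemma balancedC a b c : balanced a b c = balanced b a c.
Proof.
rewrite /balanced (goodC b a); do 2!case: good => //=; case: good => //=; do 6!case: aligned => //=.
Qed.

(** In the first alternative of [aligned_witness] the set [N a c] = [N c b] consists of [t]
common rich neighbours of [a] and [b], which then include [w]. In the second one, the same
dichotomy applied to the pair [c b] and its poor vertex [w] identifies [N a c] with [N a b]
without [w]. *)
Lemma balanced_witness a b c w : balanced a b c -> h a b w -> ~~ rich a w ->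
  [/\ N a c = N a b :\ w, N a c \subset N c b & d a b = t.+1].
Proof.
case/and5P=> gab gac gbc /and3P[abc acb bac] /and3P[bca cab cba] hw rw.
have gca : good c a by rewrite goodC.
have gcb : good c b by rewrite goodC.
have gba : good b a by rewrite goodC.
have [[nh eN dt]|[hcbw eN dt]] := aligned_witness gac gcb abc hw rw.
  have sub : N a c \subset R a :&: R b.
    apply/subsetP => z zN; rewrite !inE; apply/andP; split; apply: contraT => rz.
      have haz : h a c z by rewrite -in_nbr.
      have [[]|[_ _]] := aligned_witness gab gbc acb haz rz.
        by rewrite -in_nbr (nbrC _ b c) -eN zN.
      by rewrite codegC /codeg -eN -/(d a c) dt => /n_Sn.
    have hbz : h b c z by rewrite -in_nbr nbrC -eN.
    have [[]|[_ _]] := aligned_witness gba gac bca hbz rz.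
      by rewrite -in_nbr zN.
    by rewrite dt => /n_Sn.
  have := nbr_sub_common_rich no_book (_ : t <= #|R a :&: R b|).
  rewrite -{1}dt subset_leq_card // => /(_ isT)/subsetP/(_ w).
  by rewrite in_nbr inE inE (negbTE rw) => /(_ hw).
have [gcw _] := alignedP abc hw rw.
have [[]|[_ eN' dt']] := aligned_witness gca gab cba hcbw (good_poor gcw).
  by rewrite hw.
by split; [rewrite eN' nbrC | rewrite -eN subD1set |].
Qed.

(** Each such [c] lies in a triple with [a] (and with [b]) and any element of [N a b] other
than [w]. More than [3 * t] of them would make these [t] elements common rich neighbours of [a]
and [b], hence also [w]. *)
Lemma poor_witness_few_balanced a b w : h a b w -> ~~ rich a w ->
  #|[set c | balanced a b c]| <= 3 * t.
Proof.
move=> hw rw; rewrite leqNgt; apply/negP => many.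
have [c0 c0P] : exists c, balanced a b c.
  by have /card_gt0P[c] := leq_ltn_trans (leq0n _) many; rewrite inE; exists c.
have [_ _ dt] := balanced_witness c0P hw rw.
have sub : N a b :\ w \subset R a :&: R b.
  apply/subsetP => z zN; rewrite !inE; apply/andP; split; apply: leq_trans many _;
    apply: subset_leq_card; apply/subsetP => c; rewrite inE => /balanced_witness/(_ hw rw)[eN sN _].
    by rewrite in_nbr adjA -in_nbr eN.
  by rewrite in_nbr adjA -in_nbr nbrC (subsetP sN) // eN.
have := nbr_sub_common_rich no_book (_ : t <= #|R a :&: R b|).
have := cardsD1 w (N a b); rewrite in_nbr hw -/(d a b) dt add1n => -[eT].
rewrite {1}eT subset_leq_card // => /(_ isT)/subsetP/(_ w).
by rewrite in_nbr inE inE (negbTE rw) => /(_ hw).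
Qed.

(** In the extremal example this holds for any two vertices outside the kernel, and both sides
of the first equation are the kernel. *)
Definition settled a b := (N a b == R a :&: R b) && (d a b == t).

Lemma balanced_settled a b : 3 * t < #|[set c | balanced a b c]| -> settled a b.
Proof.
move=> many; have [c cP] : exists c, balanced a b c.
  by have /card_gt0P[c] := leq_ltn_trans (leq0n _) many; rewrite inE; exists c.
have gab : good a b by case/and5P: cP.
have sub : N a b \subset R a :&: R b.
  apply/subsetP => w; rewrite in_nbr => hw; rewrite !inE; apply/andP; split; apply: contraT => rw.
    by have := poor_witness_few_balanced hw rw; rewrite leqNgt many.
  have := poor_witness_few_balanced (_ : h b a w) rw; rewrite adjC => /(_ hw).
  by under eq_finset do rewrite balancedC; rewrite leqNgt many.
have le_t : #|R a :&: R b| <= t.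
  by apply: (card_common_rich no_book); apply: leq_trans (good_codeg gab).
rewrite /settled eqEcard sub (leq_trans le_t) ?good_codeg //= eqn_leq good_codeg // andbT.
by apply: leq_trans le_t; apply: subset_leq_card.
Qed.

End Balanced.

(** * Almost all pairs are settled and firm *)

Section Settled.

Variables (V : finType) (h : triple_system V) (t : nat).
Hypothesis no_book : ~ has_book h t.
Hypothesis t_gt0 : 0 < t.

Local Notation N := (nbr h).
Local Notation d := (codeg h).
Local Notation rich := (rich h t).
Local Notation good := (good h t).
Local Notation aligned := (aligned h t).
Local Notation balanced := (balanced h t).
Local Notation settled := (settled h t).
Local Notation busy_spines := (busy_spines h t).
Local Notation wt := (weight h t).
Local Notation spread := (spread t).
Local Notation n := #|V|.

Lemma sum_triples1 (g : V -> V -> bool) :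
  \sum_a \sum_b \sum_(c : V) (g a b : nat) = n * \sum_a #|[set b | g a b]|.
Proof.
rewrite big_distrr; apply: eq_bigr => a _ /=; rewrite -sum_predE big_distrr.
by apply: eq_bigr => b _; rewrite sum_nat_const.
Qed.

Lemma sum_triplesC (F : V -> V -> V -> nat) :
  \sum_a \sum_b \sum_c F a b c = \sum_a \sum_b \sum_c F b a c.
Proof. by rewrite exchange_big. Qed.

Lemma sum_triplesA (F : V -> V -> V -> nat) :
  \sum_a \sum_b \sum_c F a b c = \sum_a \sum_b \sum_c F a c b.
Proof. by apply: eq_bigr => a _; rewrite exchange_big. Qed.

Lemma sum_triplesD (F G : V -> V -> V -> nat) : \sum_a \sum_b \sum_c (F a b c + G a b c) =
  \sum_a \sum_b \sum_c F a b c + \sum_a \sum_b \sum_c G a b c.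
Proof.
rewrite -big_split; apply: eq_bigr => a _; rewrite -big_split; apply: eq_bigr => b _.
by rewrite big_split.
Qed.

Definition misaligned a b c := [&& good a b, good a c & ~~ aligned a b c].

(** The number of [b], for a fixed good pair [a c], lost to busy spines: directly, or through a
poor vertex [w] of [N a b] that is a busy spine. *)
Definition exposure := 3 * t * (3 * t + spread) + 3 * t * ((3 * t + spread) * (3 * t).+1).

Lemma misalignedP a b c : misaligned a b c ->
  [\/ exists w, [&& h a b w, ~~ rich a w & ~~ good c w],
      exists2 w0, h a c w0 & b \in busy_spines a c w0 (3 * t).+1 |
      exists2 w0, h a c w0 & exists2 w, w \in busy_spines a c w0 (3 * t).+1 & h a b w && ~~ rich a w].
Proof.
case/and3P=> gab gac /forallPn[w]; rewrite negb_imply => /andP[/andP[hw rw]].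
rewrite negb_and => /orP[gcw|]; first by constructor 1; exists w; rewrite hw rw.
case/forallPn => w0; rewrite negb_imply negb_and -!leqNgt => /andP[hw0 /orP[le|le]].
  constructor 2; exists w0 => //; rewrite inE; apply/existsP; exists w.
  by rewrite hw le andbT ltnS leqNgt.
constructor 3; exists w0 => //; exists w; last by rewrite hw.
rewrite inE; apply/existsP; exists b; rewrite adjA hw le andbT ltnS leqNgt.
exact: good_poor gab.
Qed.

Lemma card_poor_fibre m a w : #|[set b | h a b w && (d a w < m)]| <= m.
Proof.
have [lt|ge] := ltnP (d a w) m; last first.
  by rewrite (_ : [set b | _] = set0) ?cards0 //; apply/setP => b; rewrite !inE andbF.
apply: leq_trans (ltnW lt); apply: subset_leq_card; apply/subsetP => b.
by rewrite inE andbT in_nbr adjA.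
Qed.

Lemma sum_busy a c m (X : V -> {set V}) k : (forall w0, h a c w0 -> #|X w0| <= k) ->
  \sum_b \sum_(w0 in N a c) \sum_(w in X w0) (h a b w && (d a w < m)) <= d a c * (k * m).
Proof.
move=> Xk; rewrite exchange_big /=; rewrite -sum_nat_const; apply: leq_sum => w0; rewrite in_nbr => hw0.
rewrite exchange_big /=; apply: leq_trans (leq_mul (Xk w0 hw0) (leqnn m)).
rewrite -sum_nat_const; apply: leq_sum => w _; rewrite sum_predE; exact: card_poor_fibre.
Qed.

Lemma sum_ge1 (I : finType) (P : pred I) (F : I -> nat) i : P i -> 0 < F i -> 0 < \sum_(j | P j) F j.
Proof. by move=> Pi Fi; rewrite (bigD1 i) //= ltn_addr. Qed.

(** For a good pair [a c], which is poor, there are boundedly many bases [w0] and so boundedly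
many busy spines; the remaining failures are charged to a bad pair [c w]. *)
Lemma sum_misaligned : \sum_a \sum_b \sum_c (misaligned a b c : nat) <=
  3 * t * n * bad_pairs h t + n ^ 2 * exposure.
Proof.
have e a c : good a c -> d a c <= 3 * t.
  by move=> /(good_poor no_book t_gt0); rewrite -leqNgt.
rewrite sum_triplesA.
apply: (@leq_trans (\sum_a \sum_c (\sum_b \sum_w [&& h a b w, ~~ rich a w & ~~ good c w] + exposure))).
  apply: leq_sum => a _; apply: leq_sum => c _.
  have [gac|ngac] := boolP (good a c); last first.
    by rewrite big1 // => b _; rewrite /misaligned (negbTE ngac) andbF.
  pose B w0 := busy_spines a c w0 (3 * t).+1.
  have Bk w0 : h a c w0 -> #|B w0| <= 3 * t + spread.
    move=> hw0; apply: leq_trans (card_busy_spines no_book t_gt0 _ hw0) _ => //.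
    by rewrite -addnA leq_add2r e.
  apply: (@leq_trans (\sum_b (\sum_w [&& h a b w, ~~ rich a w & ~~ good c w] +
     (\sum_(w0 in N a c) (b \in B w0) +
      \sum_(w0 in N a c) \sum_(w in B w0) (h a b w && (d a w < (3 * t).+1)))))).
    apply: leq_sum => b _; case: (boolP (misaligned a b c)) => // /misalignedP[[w Pw]|[w0 hw0 Bw0]|[w0 hw0 [w wB Pw]]].
    - by apply: leq_trans (leq_addr _ _); apply: (@sum_ge1 _ _ _ w); rewrite ?Pw.
    - apply: leq_trans (leq_addl _ _); apply: leq_trans (leq_addr _ _).
      by apply: (@sum_ge1 _ _ _ w0); rewrite ?in_nbr ?Bw0.
    apply: leq_trans (leq_addl _ _); apply: leq_trans (leq_addl _ _).
    apply: (@sum_ge1 _ _ _ w0); rewrite ?in_nbr //; apply: (@sum_ge1 _ _ _ w) => //.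
    by move: Pw; rewrite (ltnS (d a w)) (leqNgt (d a w)) => ->.
  rewrite big_split leq_add2l big_split leq_add //=.
    rewrite exchange_big /=; apply: leq_trans (leq_mul (e a c gac) (leqnn _)).
    rewrite -sum_nat_const; apply: leq_sum => w0; rewrite in_nbr => /Bk.
    by rewrite sum_mem.
  by apply: leq_trans (sum_busy _ Bk) _; rewrite leq_mul2r e ?orbT.
under eq_bigr do rewrite big_split sum_nat_const /=.
rewrite big_split sum_nat_const /= -mulnn -[n * n * _]mulnA leq_add2r.
rewrite [leqRHS](_ : _ = \sum_(a : V) 3 * t * bad_pairs h t); last first.
  by rewrite sum_nat_const mulnCA mulnA.
apply: leq_sum => a _.
apply: (@leq_trans (\sum_c \sum_w \sum_b [&& h a b w, ~~ rich a w & ~~ good c w])).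
  by apply: leq_sum => c _; rewrite exchange_big.
rewrite /bad_pairs big_distrr; apply: leq_sum => c _ /=; rewrite -sum_mem big_distrr.
apply: leq_sum => w _; rewrite inE /= -/(good c w).
have [gcw|gcw] := boolP (good c w); first by rewrite big1 // => b _; rewrite !andbF.
rewrite muln1 /=; have [rw|rw] := boolP (rich a w).
  by rewrite big1 // => b _; rewrite andbF.
apply: (@leq_trans (\sum_b (b \in N a w))); last by rewrite sum_mem leqNgt.
by apply: leq_sum => b _; rewrite in_nbr adjA; case: (adj _ _ _ _) => //=; case: (~~ _).
Qed.

Definition unsettled_pairs := \sum_a #|[set b | ~~ settled a b]|.

Lemma unbalanced_le a b c : ~~ balanced a b c <=
  (~~ good a b) + (~~ good a c) + (~~ good b c) +
  (misaligned a b c + misaligned a c b + misaligned b a c + misaligned b c a +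
   misaligned c a b + misaligned c b a).
Proof.
rewrite /balanced /misaligned !(goodC h t b a) !(goodC h t c a) !(goodC h t c b).
by do 3!case: good => //=; do 6!case: aligned => //=.
Qed.

Lemma sum_unbalanced : \sum_a \sum_b \sum_c (~~ balanced a b c : nat) <=
  3 * n * bad_pairs h t + 6 * (3 * t * n * bad_pairs h t + n ^ 2 * exposure).
Proof.
apply: (@leq_trans (\sum_a \sum_b \sum_c ((~~ good a b) + (~~ good a c) + (~~ good b c) +
  (misaligned a b c + misaligned a c b + misaligned b a c + misaligned b c a +
   misaligned c a b + misaligned c b a)))).
  by do 3!(apply: leq_sum => ? _); apply: unbalanced_le.
rewrite !sum_triplesD; set S := \sum_a \sum_b \sum_c (misaligned a b c : nat).
have -> : \sum_a \sum_b \sum_c (misaligned a c b : nat) = S by rewrite sum_triplesA.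
have -> : \sum_a \sum_b \sum_c (misaligned b a c : nat) = S by rewrite sum_triplesC.
have -> : \sum_a \sum_b \sum_c (misaligned b c a : nat) = S.
  by rewrite sum_triplesC sum_triplesA.
have -> : \sum_a \sum_b \sum_c (misaligned c a b : nat) = S.
  by rewrite sum_triplesA sum_triplesC.
have -> : \sum_a \sum_b \sum_c (misaligned c b a : nat) = S.
  by rewrite sum_triplesC sum_triplesA sum_triplesC.
have -> : \sum_(a : V) \sum_b \sum_c (~~ good b c : nat) = \sum_a \sum_b \sum_(c : V) (~~ good a b : nat).
  by rewrite sum_triplesC sum_triplesA.
rewrite [X in _ + X + _ + _]sum_triplesA !sum_triples1 -/(bad_pairs h t).
by have := sum_misaligned; rewrite -/S; move: (bad_pairs h t) => P; clear; lia.
Qed.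

Lemma unsettled_pairs_le : (n - 3 * t) * unsettled_pairs <=
  3 * n * bad_pairs h t + 6 * (3 * t * n * bad_pairs h t + n ^ 2 * exposure).
Proof.
apply: leq_trans sum_unbalanced; rewrite big_distrr; apply: leq_sum => a _ /=.
rewrite -sum_predE big_distrr; apply: leq_sum => b _ /=.
case: (boolP (settled a b)) => [_|ns]; first by rewrite muln0.
rewrite muln1 sum_predE leq_subLR -(cardsC [set c | balanced a b c]); apply: leq_add.
  by rewrite leqNgt; apply: contra ns => /(balanced_settled no_book t_gt0).
by apply: subset_leq_card; apply/subsetP => c; rewrite !inE.
Qed.

Definition weak m a b := [exists w, h a b w && (d a w < m)].
Definition exposure_per_codeg := t * (t + 1 + 5 * t) + t * (t + spread).

(** Let [w] in [N a b] have small codegree with [a]. If [c b w] is a triple, then [c w] is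
rich, so [w] is a busy spine for the core [a c]. Otherwise [N a c] is not contained in [N c b],
since equal neighbourhoods would put [w] in [N c b]; a base in the difference makes [b] a busy
spine. *)
Lemma settled_weak_clash m a b c w : settled a b -> settled a c -> settled c b ->
  h a b w -> d a w < m ->
  (exists2 w0, h a c w0 & b \in busy_spines a c w0 m) \/
  (exists2 w0, h a c w0 & exists2 w, w \in busy_spines a c w0 (3 * t).+1 & h a b w && (d a w < m)).
Proof.
move=> /andP[/eqP Nab /eqP dab] /andP[/eqP Nac /eqP dac] /andP[/eqP Ncb /eqP dcb] hw lt_m.
have [w0 w0N] : exists w0, w0 \in N a c by apply/card_gt0P; rewrite -/(d a c) dac.
have hw0 : h a c w0 by rewrite -in_nbr.
have [hcbw|nhcbw] := boolP (h c b w).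
  right; exists w0 => //; exists w; last by rewrite hw.
  rewrite inE; apply/existsP; exists b; rewrite adjA hw dab ltnS leq_pmull //=.
  have : rich c w by move: hcbw; rewrite -in_nbr Ncb !inE => /andP[].
  move=> rcw; have : 3 * t < #|N c w :\: [set w0; b]| + 2.
    apply: leq_trans rcw _; apply: leq_trans (card_setD2 _ w0 b) _.
    by rewrite -addnA leq_add2l (leq_add (leq_b1 _) (leq_b1 _)).
  by move: t_gt0; clear; lia.
left; have [v vN vNcb] : exists2 v, v \in N a c & v \notin N c b.
  apply/subsetPn; apply/negP => sub.
  have eN : N a c = N c b by apply/eqP; rewrite eqEcard sub -/(d c b) -/(d a c) dcb dac leqnn.
  have eN' : N a c = N a b.
    apply/eqP; rewrite eqEcard -/(d a c) -/(d a b) dac dab leqnn andbT.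
    apply/subsetP => z zN; rewrite Nab inE; move: (zN); rewrite {1}Nac inE => /andP[-> _].
    by move: zN; rewrite eN Ncb inE => /andP[].
  by move: nhcbw; rewrite -in_nbr -eN eN' in_nbr hw.
exists v; first by rewrite -in_nbr.
rewrite inE; apply/existsP; exists w; rewrite hw lt_m /=.
have := card_setD2 (N c b) v w; rewrite -/(d c b) dcb (negbTE vNcb) [w \in _]in_nbr (negbTE nhcbw).
by rewrite !addn0.
Qed.

Definition firm m a b := settled a b && ~~ weak m a b.

(** Summing over an auxiliary vertex [c] turns the clash into a count of busy spines, which is
linear in the scale [m]. *)
Lemma nonfirm_le m : 0 < m -> 0 < n ->
  \sum_a #|[set b | ~~ firm m a b]| <= 3 * unsettled_pairs + m * exposure_per_codeg * n.
Proof.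
move=> m_gt0 n_gt0; pose Y := \sum_a #|[set b | settled a b && weak m a b]|.
suff leY : Y <= 2 * unsettled_pairs + m * exposure_per_codeg * n.
  apply: (@leq_trans (unsettled_pairs + Y)); last by move: leY; clear; lia.
  rewrite -big_split; apply: leq_sum => a _; apply: leq_trans (leq_card_setU _ _).
  apply: subset_leq_card; apply/subsetP => b; rewrite !inE /firm.
  by case: (settled a b) => //=; rewrite negbK.
rewrite -(leq_pmul2l n_gt0) -sum_triples1 sum_triplesA.
apply: (@leq_trans (\sum_a \sum_c (\sum_b ((~~ settled a c) + (~~ settled c b)) + m * exposure_per_codeg))).
  apply: leq_sum => a _; apply: leq_sum => c _.
  have [sac|nsac] := boolP (settled a c); last first.
    apply: leq_trans (leq_addr _ _); apply: leq_sum => b _ /=.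
    by apply: leq_trans (leq_b1 _) _; rewrite leq_addr.
  have dac : d a c = t by case/andP: sac => _ /eqP.
  have B1k w0 : h a c w0 -> #|busy_spines a c w0 m| <= m * (t + 1 + 5 * t).
    move=> hw0; apply: leq_trans (card_busy_spines no_book t_gt0 m_gt0 hw0) _; rewrite dac.
    by move: m_gt0; clear; nia.
  have B2k w0 : h a c w0 -> #|busy_spines a c w0 (3 * t).+1| <= t + spread.
    by move=> hw0; apply: leq_trans (card_busy_spines no_book t_gt0 _ hw0) _ => //; rewrite dac addnA.
  apply: (@leq_trans (\sum_b ((~~ settled c b) +
     (\sum_(w0 in N a c) (b \in busy_spines a c w0 m) +
      \sum_(w0 in N a c) \sum_(w in busy_spines a c w0 (3 * t).+1) (h a b w && (d a w < m)))))).
    apply: leq_sum => b _; have [scb|nscb] := boolP (settled c b); last first.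
      by apply: leq_trans (leq_b1 _) _; rewrite leq_addr.
    rewrite /= add0n.
    case: (boolP (_ && _)) => // /andP[sab /existsP[w /andP[hw ltw]]].
    have [[w0 hw0 Bw0]|[w0 hw0 [w' w'B Pw']]] := settled_weak_clash sab sac scb hw ltw.
      by apply: leq_trans (leq_addr _ _); apply: (@sum_ge1 _ _ _ w0); rewrite ?in_nbr ?Bw0.
    apply: leq_trans (leq_addl _ _).
    apply: (@sum_ge1 _ _ _ w0); rewrite ?in_nbr //; apply: (@sum_ge1 _ _ _ w') => //.
    by rewrite Pw'.
  rewrite big_split leq_add //= big_split /exposure_per_codeg mulnDr leq_add //=.
    rewrite exchange_big /= mulnCA -[X in _ <= X * _]dac -sum_nat_const; apply: leq_sum => w0.
    by rewrite in_nbr sum_mem => /B1k.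
  apply: leq_trans (sum_busy _ B2k) _; rewrite dac.
  by rewrite mulnA mulnC.
under eq_bigr do rewrite big_split sum_nat_const /=.
rewrite big_split sum_nat_const sum_triplesD /= sum_triples1.
rewrite [X in _ + X + _](_ : _ = n * unsettled_pairs); last first.
  by rewrite sum_triplesC sum_triplesA sum_triples1.
by rewrite mulnDr mul2n -addnn mulnDr leq_add2l [X in _ <= _ * X]mulnC.
Qed.

End Settled.

(** * Popular neighbourhoods *)

Lemma markov (V : finType) (F : V -> nat) c S :
  \sum_x F x <= S -> c * #|[set x | c < F x]| <= S.
Proof.
apply: leq_trans; rewrite -sum_predE big_distrr; apply: leq_sum => x _ /=.
by case: ltnP => [/ltnW|_]; rewrite ?muln1 ?muln0.
Qed.

Lemma pigeonhole_sets (V : finType) (Z W : {set V}) (f : V -> {set V}) :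
  (forall z, z \in Z -> f z \subset W) ->
  exists2 T : {set V}, T \subset W & #|Z| <= 2 ^ #|W| * #|[set z in Z | f z == T]|.
Proof.
move=> fW; pose cnt T := #|[set z in Z | f z == T]|.
have W0 : set0 \in powerset W by rewrite powersetE sub0set.
case: (arg_maxnP cnt W0) => T TW Tmax; exists T; first by rewrite -powersetE.
rewrite -card_powerset -sum_nat_const.
apply: (@leq_trans (\sum_(T' in powerset W) cnt T')); last exact: leq_sum.
under eq_bigr => T' _ do rewrite /cnt -sum_mem.
rewrite exchange_big /= -sum_mem; apply: leq_sum => z _; case: (boolP (z \in Z)) => // zZ.
rewrite (bigD1 (f z)) /=; last by rewrite powersetE fW.
by rewrite inE zZ eqxx.
Qed.

Lemma divn_ge_half n q : 0 < q -> q <= n -> n <= 2 * q * (n %/ q).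
Proof.
move=> q_gt0 le_qn; have := divn_eq n q; have := ltn_pmod n q_gt0.
have : 0 < n %/ q by rewrite divn_gt0.
move: (n %/ q) (n %% q) => a b; clear; nia.
Qed.

(** Averaging over the third vertex [c] loses a factor [n], which the bounds for
unbalanced triples contain as well. *)
Lemma few_exceptional_pairs t Q : 0 < t -> exists n0, forall (V : finType) (h : triple_system V),
  n0 <= #|V| -> ~ has_book h t -> 3 * t * (#|V| - t) * (#|V| - t.+1) <= triples h ->
  Q * bad_pairs h t <= #|V| ^ 2 /\ Q * unsettled_pairs h t <= #|V| ^ 2.
Proof.
move=> t_gt0; pose E := exposure t; pose Q' := Q + 2 * Q * (6 + 36 * t).
have [n1 n1P] := few_bad_pairs Q' t_gt0.
exists (n1 + 24 * E * Q + 6 * t) => V h le_n nb le_tr.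
have leP : Q' * bad_pairs h t <= #|V| ^ 2 by apply: n1P => //; move: le_n; clear; lia.
split; first by apply: leq_trans leP; rewrite leq_mul2r leq_addr orbT.
have := unsettled_pairs_le nb t_gt0; rewrite -/E; move: leP le_n.
move: (bad_pairs h t) (unsettled_pairs h t) #|V| => P U n leP le_n leU.
have n_gt0 : 0 < n by move: le_n t_gt0; clear; lia.
have {}leU : n * U <= n * ((6 + 36 * t) * P + 12 * E * n).
  apply: (@leq_trans (2 * ((n - 3 * t) * U))).
    by rewrite mulnA leq_mul2r; apply/orP; right; move: le_n; clear; lia.
  by move: leU; clear; nia.
rewrite leq_pmul2l // in leU.
have leEn : 24 * E * Q * n <= n ^ 2 by rewrite -mulnn leq_mul2r; apply/orP; right; move: le_n; clear; lia.
rewrite -(leq_pmul2l (isT : 0 < 2)); apply: (@leq_trans (n ^ 2 + n ^ 2)); last by rewrite addnn mul2n.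
apply: (@leq_trans (2 * Q * (6 + 36 * t) * P + 24 * E * Q * n)).
  rewrite mulnA; apply: leq_trans (leq_mul (leqnn (2 * Q)) leU) _.
  by rewrite mulnDr leq_eqVlt; apply/orP; left; apply/eqP; clear; nia.
by apply: leq_add => //; apply: leq_trans leP; rewrite leq_mul2r leq_addl orbT.
Qed.

Section Kernel.

Variables (V : finType) (h : triple_system V) (t : nat).
Hypothesis no_book : ~ has_book h t.
Hypothesis t_gt0 : 0 < t.

Local Notation N := (nbr h).
Local Notation d := (codeg h).
Local Notation R := (rich_nbrs h t).
Local Notation settled := (settled h t).
Local Notation firm := (firm h t).
Local Notation n := #|V|.

Definition link_size x := \sum_w d x w.

Lemma sum_link_size : \sum_x link_size x <= 6 * t * n ^ 2.
Proof.
apply: leq_trans (triples_shadow no_book t_gt0) _; rewrite leq_mul2l; apply/orP; right.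
by rewrite -mulnn -card_prod max_card.
Qed.

(** With a link of size at most [c * n], the vertex [x] has at most [2 * q * c] vertices of
codegree at least [m], and firm neighbourhoods are subsets of these. *)
Lemma popular_pattern m q x c (Z : {set V}) :
  n <= 2 * q * m -> 0 < n -> link_size x <= c * n ->
  (forall z, z \in Z -> firm m x z) ->
  exists T : {set V}, #|Z| <= 2 ^ (2 * q * c) * #|[set z in Z | N x z == T]|.
Proof.
move=> le_n n_gt0 le_link Zfirm; pose W := [set w | m <= d x w].
have [z /Zfirm/andP[_ nw]|T TW le_Z] := @pigeonhole_sets V Z W (N x).
  apply/subsetP => w; rewrite in_nbr inE => hw.
  by move/existsPn/(_ w): nw; rewrite hw -leqNgt.
exists T; apply: leq_trans le_Z _; rewrite leq_mul2r leq_exp2l //; apply/orP; right.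
have m_gt0 : 0 < m by move: le_n; case: (m) => //; rewrite muln0; case: (n) n_gt0.
rewrite -(leq_pmul2r m_gt0); apply: (@leq_trans (link_size x)).
  rewrite -sum_nat_const [leqRHS](bigID (mem W)) /= -[leqLHS]addn0 leq_add //.
  by apply: leq_sum => w; rewrite inE.
apply: leq_trans le_link _; apply: (@leq_trans (c * (2 * q * m))); first by rewrite leq_mul2l le_n orbT.
by rewrite mulnCA mulnA.
Qed.

Definition popular (S : {set V}) := [set y | S \subset R y].

Lemma firm_pattern m x z T : firm m x z -> N x z = T -> [/\ T \subset R x, T \subset R z & #|T| = t].
Proof.
case/andP=> /andP[/eqP eN /eqP dt] _ <-; split=> //.
  by rewrite eN subsetIl.
by rewrite eN subsetIr.
Qed.

(** Two members of [Z] have the more than [t] elements of [T] and [T'] as common rich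
neighbours, so they lie in no common triple, and their pair has weight zero. *)
Lemma two_patterns_independent (T T' : {set V}) (Z : {set V}) : #|T| = t -> #|T'| = t -> T != T' ->
  (forall z, z \in Z -> (T \subset R z) && (T' \subset R z)) ->
  #|Z| ^ 2 <= bad_pairs h t.
Proof.
move=> cT cT' neq ZP.
have ltU : t < #|T :|: T'|.
  rewrite -{1}cT; apply: proper_card; rewrite properE subsetUl subUset subxx /=.
  by apply: contra neq => sub; rewrite eq_sym eqEcard sub cT cT' leqnn.
have ind z z' : z \in Z -> z' \in Z -> d z z' = 0.
  move=> /ZP/andP[Tz T'z] /ZP/andP[Tz' T'z']; apply/eqP; rewrite -leqn0 leqNgt.
  apply/negP => /(card_common_rich no_book); apply/negP; rewrite -ltnNge; apply: leq_trans ltU _.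
  by apply: subset_leq_card; rewrite subUset !subsetI Tz Tz' T'z T'z'.
rewrite -mulnn -sum_nat_const [leqRHS](bigID (mem Z)) /= -[leqLHS]addn0 leq_add //.
apply: leq_sum => z zZ; apply: subset_leq_card; apply/subsetP => z' z'Z; rewrite inE.
have := weight_le_codeg h t z z'; rewrite ind // muln0 leqn0 => /eqP->.
by rewrite eq_sym -lt0n muln_gt0.
Qed.

End Kernel.

(** * A kernel of t vertices *)

Lemma exists_outside2 (V : finType) (B X Y : {set V}) :
  #|X| + #|Y| < #|B| -> exists2 y, y \in B & (y \notin X) && (y \notin Y).
Proof.
move=> lt; have [y yB] : exists2 y, y \in B & y \notin X :|: Y.
  apply/subsetPn/negP => /subset_leq_card; apply/negP; rewrite -ltnNge.
  exact: leq_ltn_trans (leq_card_setU _ _) lt.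
by rewrite in_setU negb_or; exists y.
Qed.

Lemma quarter_le c a n k : 0 < c -> 0 < n -> 4 * c * a * n * k <= c * n ^ 2 -> 4 * (a * k) <= n.
Proof.
move=> c_gt0 n_gt0 le; rewrite -(leq_pmul2l (_ : 0 < c * n)) ?muln_gt0 ?c_gt0 //.
by rewrite -[leqRHS]mulnA mulnn; apply: leq_trans le; rewrite leq_eqVlt; apply/orP; left; apply/eqP; ring.
Qed.

(** The scale of the second pattern has to be small compared with the proportion of
vertices that take the first one, and this determines the order in which the constants are chosen. *)
Lemma exists_kernel t Q : 0 < t -> 0 < Q -> exists n0, forall (V : finType) (h : triple_system V),
  n0 <= #|V| -> ~ has_book h t -> 3 * t * (#|V| - t) * (#|V| - t.+1) <= triples h ->
  exists S : {set V}, [/\ #|S| = t, Q * #|[set y | ~~ (S \subset rich_nbrs h t y)]| <= #|V|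
    & Q * unsettled_pairs h t <= #|V| ^ 2].
Proof.
move=> t_gt0 Q_gt0; pose C := exposure_per_codeg t.
have C_gt0 : 0 < C by rewrite addn_gt0 muln_gt0 t_gt0 !addn_gt0 t_gt0.
pose q1 := 16 * C; pose p1 := 2 ^ (2 * q1 * (24 * t)).
have p1_gt0 : 0 < p1 by rewrite expn_gt0.
pose q2 := 32 * Q * p1 * C; pose p2 := 2 ^ (2 * q2 * (24 * t * Q)).
have q1_gt0 : 0 < q1 by rewrite muln_gt0.
have q2_gt0 : 0 < q2 by rewrite !muln_gt0 Q_gt0 p1_gt0.
pose K := 48 + 96 * Q * p1 + 2 * (4 * p1 * p2) ^ 2 + Q.
have [n1 n1P] := few_exceptional_pairs K t_gt0.
exists (n1 + q1 + q2 + 1) => V h le_n nb le_tr.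
have [|leP leU] := n1P V h _ nb le_tr; first by move: le_n; clear; lia.
have n_gt0 : 0 < #|V| by move: le_n; clear; lia.
have nf m := nonfirm_le nb t_gt0 (m := m).
have links := sum_link_size nb t_gt0.
pose bad m x := #|[set z | ~~ firm h t m x z]|.
have half m x c : 2 * bad m x <= c -> forall Z : {set V}, c <= #|Z| ->
    #|Z| <= 2 * #|[set z in Z | firm h t m x z]|.
  move=> le_c Z cZ.
  have : #|Z| <= #|[set z in Z | firm h t m x z]| + bad m x.
    apply: leq_trans (leq_card_setU _ _); apply: subset_leq_card; apply/subsetP => z zZ.
    by rewrite !inE zZ /= orbN.
  by move: le_c cZ; clear; lia.
have weaken k : k <= K -> k * unsettled_pairs h t <= #|V| ^ 2.
  by move=> le_k; apply: leq_trans leU; rewrite leq_mul2r le_k orbT.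
(* At the scale m1 a typical vertex x is firm with half of the vertices; the pattern T is
   taken by a positive proportion A of them. *)
pose m1 := #|V| %/ q1.
have m1_ge : #|V| <= 2 * q1 * m1 by apply: divn_ge_half => //; move: le_n; clear; lia.
have m1_gt0 : 0 < m1 by rewrite divn_gt0 //; move: le_n; clear; lia.
have F1 : 8 * \sum_x bad m1 x <= #|V| ^ 2.
  have := nf m1 m1_gt0 n_gt0; rewrite -/C.
  have le48 : 48 * unsettled_pairs h t <= #|V| ^ 2.
    by apply: weaken; rewrite /K -!addnA leq_addr.
  have : 16 * (m1 * C * #|V|) <= #|V| ^ 2.
    rewrite (_ : 16 * _ = m1 * q1 * #|V|); last by rewrite /q1; clear; lia.
    by rewrite -mulnn leq_mul2r leq_trunc_div orbT.
  move: le48; rewrite /bad; move: (\sum_x _) (unsettled_pairs h t) (m1 * C * _) => a b c.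
  by clear; lia.
have [x _ /andP[badx linkx]] : exists2 x, x \in [set: V] &
    (x \notin [set x | #|V| < 2 * bad m1 x]) && (x \notin [set x | 24 * t * #|V| < link_size h x]).
  apply: exists_outside2; rewrite cardsT.
  have := @markov V (fun x => 2 * bad m1 x) #|V| (2 * \sum_x bad m1 x).
  rewrite -big_distrr /= => /(_ (leqnn _)) M1.
  have M2 := @markov V (link_size h) (24 * t * #|V|) _ links.
  have {}M1 : 4 * #|[set x | #|V| < 2 * bad m1 x]| <= #|V|.
    rewrite -(leq_pmul2l n_gt0) mulnCA mulnn; apply: leq_trans F1.
    by rewrite -[8]/(4 * 2) -mulnA leq_mul2l.
  have {}M2 : 4 * #|[set x | 24 * t * #|V| < link_size h x]| <= #|V|.
    rewrite -[X in 4 * X]mul1n; apply: (@quarter_le (6 * t)) => //; first by rewrite muln_gt0.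
    by rewrite muln1 mulnA.
  rewrite -(ltn_pmul2l (isT : 0 < 4)) mulnDr; apply: leq_ltn_trans (leq_add M1 M2) _.
  by rewrite addnn -mul2n ltn_pmul2r.
rewrite inE -leqNgt in badx; rewrite inE -leqNgt in linkx.
pose Z := [set z in [set: V] | firm h t m1 x z].
have leZ : #|V| <= 2 * #|Z| by have := half m1 x _ badx [set: V]; rewrite cardsT => /(_ (leqnn _)).
have [|T leA] := @popular_pattern V h t _ _ _ _ Z m1_ge n_gt0 linkx.
  by move=> z; rewrite !inE.
set A := [set z in Z | _] in leA; rewrite -/p1 in leA.
have A_gt0 : 0 < #|A|.
  by move: leA leZ n_gt0; case: #|A| => //; rewrite muln0; clear; lia.
have AP z : z \in A -> [/\ T \subset rich_nbrs h t x, T \subset rich_nbrs h t z & #|T| = t].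
  by case/setIdP; rewrite !inE => /firm_pattern F /eqP /F.
have /card_gt0P[z0 /AP[_ _ cT]] := A_gt0.
exists T; split=> //; last by apply: weaken; rewrite /K leq_addl.
set B := [set y | _]; rewrite leqNgt; apply/negP => ltB.
have nA : #|V| <= 2 * p1 * #|A|.
  by rewrite -mulnA; apply: leq_trans leZ _; rewrite leq_mul2l leA orbT.
(* If more than a proportion 1 / Q of the vertices y failed to be rich to T, one of them
   would be typical at the scale m2, which is small compared with A, and would have a
   popular pattern T' inside A. As y is rich to T' but not to T, the patterns differ. *)
pose m2 := #|V| %/ q2.
have m2_ge : #|V| <= 2 * q2 * m2 by apply: divn_ge_half => //; move: le_n; clear; lia.
have m2_gt0 : 0 < m2 by rewrite divn_gt0 //; move: le_n; clear; lia.
have F2 : 16 * Q * p1 * \sum_x bad m2 x <= #|V| ^ 2.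
  have := nf m2 m2_gt0 n_gt0; rewrite -/C.
  have le96 : 96 * Q * p1 * unsettled_pairs h t <= #|V| ^ 2.
    by apply: weaken; rewrite /K (addnC 48) -!addnA leq_addr.
  have : 32 * Q * p1 * (m2 * C * #|V|) <= #|V| ^ 2.
    rewrite (_ : 32 * Q * p1 * _ = m2 * q2 * #|V|); last by rewrite /q2; clear; lia.
    by rewrite -mulnn leq_mul2r leq_trunc_div orbT.
  move: le96; rewrite /bad; move: (\sum_x _) (unsettled_pairs h t) (m2 * C * _) => a b c.
  rewrite -!(mulnA _ Q) -!(mulnA _ (Q * p1)); move: (Q * p1) => k leb lec lea.
  have := leq_mul (leqnn (32 * k)) lea; move: (#|V| ^ 2) leb lec => n2; clear; lia.
have [y yB /andP[bady linky]] : exists2 y, y \in B &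
    (y \notin [set y | #|A| < 2 * bad m2 y]) && (y \notin [set y | 24 * t * Q * #|V| < link_size h y]).
  apply: exists_outside2.
  have := @markov V (fun x => 2 * bad m2 x) #|A| (2 * \sum_x bad m2 x).
  rewrite -big_distrr /= => /(_ (leqnn _)) M1.
  have M2 := @markov V (link_size h) (24 * t * Q * #|V|) _ links.
  have {}M1 : 4 * (Q * #|[set x | #|A| < 2 * bad m2 x]|) <= #|V|.
    rewrite -(leq_pmul2l n_gt0) mulnn; apply: leq_trans F2.
    apply: (@leq_trans (2 * p1 * #|A| * (4 * (Q * #|[set x | #|A| < 2 * bad m2 x]|)))).
      by rewrite leq_mul2r nA orbT.
    move: (leq_mul (leqnn (8 * Q * p1)) M1); apply: etrans; congr (_ <= _); ring.
  have {}M2 : 4 * (Q * #|[set x | 24 * t * Q * #|V| < link_size h x]|) <= #|V|.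
    apply: (@quarter_le (6 * t)) => //; first by rewrite muln_gt0.
    by rewrite mulnA.
  rewrite -(ltn_pmul2l Q_gt0) -(ltn_pmul2l (isT : 0 < 4)) !mulnDr.
  apply: leq_ltn_trans (leq_add M1 M2) _; rewrite addnn -mul2n.
  by apply: (@leq_ltn_trans (4 * #|V|)); rewrite ?leq_mul2r ?ltn_pmul2l ?orbT.
rewrite inE -leqNgt in bady; rewrite inE -leqNgt in linky.
pose Z' := [set z in A | firm h t m2 y z].
have leZ' : #|A| <= 2 * #|Z'| by exact: half m2 y _ bady A (leqnn _).
have [|T' leA'] := @popular_pattern V h t _ _ _ _ Z' m2_ge n_gt0 linky.
  by move=> z /setIdP[].
set A' := [set z in Z' | _] in leA'; rewrite -/p2 in leA'.
have A'_gt0 : 0 < #|A'|.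
  by move: leA' leZ' A_gt0; case: #|A'| => //; rewrite muln0; clear; lia.
have A'P z : z \in A' -> [/\ T' \subset rich_nbrs h t y, T' \subset rich_nbrs h t z & #|T'| = t].
  by case/setIdP => /setIdP[_ /firm_pattern F] /eqP /F.
have /card_gt0P[z1 /A'P[T'y _ cT']] := A'_gt0.
have neqT : T != T' by apply: contraTneq yB => eT; rewrite inE eT T'y.
have sq : #|A'| ^ 2 <= bad_pairs h t.
  apply: (two_patterns_independent nb t_gt0 cT cT' neqT) => z zA'.
  have [_ -> _] := A'P z zA'; rewrite andbT.
  by case/setIdP: zA' => /setIdP[/AP[_ -> _]].
have nA' : #|V| <= 4 * p1 * p2 * #|A'|.
  apply: leq_trans nA _; rewrite (mulnC 4 p1) -!mulnA mulnCA leq_mul2l; apply/orP; right.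
  by move: leZ' leA'; clear; lia.
have := leq_mul nA' nA'; rewrite !mulnn expnMn => le2.
have : 2 * (4 * p1 * p2) ^ 2 * bad_pairs h t <= #|V| ^ 2.
  apply: leq_trans leP; rewrite leq_mul2r; apply/orP; right.
  by rewrite /K -addnA; apply: leq_trans (leq_addl _ _); apply: leq_addr.
have := leq_mul (leqnn ((4 * p1 * p2) ^ 2)) sq.
have : 0 < #|V| ^ 2 by rewrite expn_gt0 n_gt0.
by move: le2; move: (_ ^ 2) (_ ^ 2) (_ ^ 2) (bad_pairs h t) => a b c e; clear; lia.
Qed.

(** * Triples that avoid the kernel *)

Section Restriction.

Variables (V : finType) (h : triple_system V) (A C : {set V}).

Definition two_in x y z := [|| [&& x \in A, y \in A & z \in C],
  [&& x \in A, z \in A & y \in C] | [&& y \in A, z \in A & x \in C]].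

Lemma restrictC x y z : h x y z && two_in x y z = h y x z && two_in y x z.
Proof.
rewrite adjC /two_in; do 6!case: (_ \in _) => //=.
Qed.

Lemma restrictA x y z : h x y z && two_in x y z = h x z y && two_in x z y.
Proof.
rewrite adjA /two_in; do 6!case: (_ \in _) => //=.
Qed.

Lemma restrict_neq x y z : h x y z && two_in x y z -> x != y.
Proof. by case/andP => /adj_neq. Qed.

Definition restrict := TripleSystem restrictC restrictA restrict_neq.

Lemma restrict_book t : has_book restrict t -> has_book h t.
Proof.
case=> u [v [w [cs [szcs /andP[hw _] /allP csP csU]]]]; exists u, v, w, cs; split=> //.
by apply/allP => c /csP /andP[/andP[h1 _] /andP[h2 _]]; rewrite /cherry h1 h2.
Qed.

(** The restricted system is again free of books, so its triples are bounded by its shadow;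
this is how triples confined to small sets are counted. *)
Lemma sum_restrict_le : \sum_(a in A) \sum_(b in A) \sum_(c in C) h a b c <= triples restrict.
Proof.
rewrite big_mkcond; apply: leq_sum => a _; case: (boolP (a \in A)) => // aA.
rewrite big_mkcond; apply: leq_sum => b _; case: (boolP (b \in A)) => // bA.
rewrite big_mkcond /codeg -sum_mem; apply: leq_sum => c _; rewrite in_nbr.
by case: (boolP (c \in C)) => // cC; rewrite /= /two_in aA bA cC /= andbT.
Qed.

End Restriction.

Section Exact.

Variables (V : finType) (h : triple_system V) (t : nat).
Hypothesis no_book : ~ has_book h t.
Hypothesis t_gt0 : 0 < t.
Variables (S : {set V}) (eta : nat).
Hypothesis cS : #|S| = t.

Local Notation N := (nbr h).
Local Notation d := (codeg h).
Local Notation rich := (rich h t).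
Local Notation R := (rich_nbrs h t).
Local Notation n := #|V|.

Definition attached y := S \subset R y.
Definition loose := [set y | (y \notin S) && ~~ attached y].
Definition unlinked c := [set x | [forall s in S, ~~ h s c x]].
Definition tight := [set c | [&& c \notin S, attached c & #|unlinked c| <= eta]].
Definition slack := [set c | [&& c \notin S, attached c & eta < #|unlinked c|]].

Lemma attachedP y s : attached y -> s \in S -> rich y s.
Proof. by move=> /subsetP yS /yS; rewrite inE. Qed.

(** All attached vertices would be common rich neighbours of [s] and [s']. *)
Lemma kernel_pair_free s s' c : t < #|[set y | attached y]| ->
  s \in S -> s' \in S -> ~~ h s s' c.
Proof.
move=> many sS s'S; apply/negP => hc.
have : #|R s :&: R s'| <= t.
  by apply: (card_common_rich no_book); apply/card_gt0P; exists c; rewrite in_nbr.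
apply/negP; rewrite -ltnNge; apply: leq_trans many _; apply: subset_leq_card.
apply/subsetP => y; rewrite !inE => ay.
by rewrite richC (attachedP ay sS) richC (attachedP ay s'S).
Qed.

(** The kernel would consist of [t] common rich neighbours of [a] and [b] other than [c]. *)
Lemma attached_pair_free a b c : c \notin S -> attached a -> attached b -> ~~ h a b c.
Proof.
move=> cNS /subsetP aS /subsetP bS; apply/negP => /(card_common_rich_without no_book).
apply/negP; rewrite -leqNgt -{1}cS; apply: subset_leq_card; apply/subsetP => s sS.
rewrite in_setD1 in_setI aS // bS // !andbT.
by apply: contraNneq cNS => <-.
Qed.

Lemma tight_loose x y : x \in tight -> y \in loose -> x != y.
Proof.
rewrite !inE => /and3P[_ ay _] /andP[_ lx].
by apply: contraNneq lx => <-.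
Qed.

(** A book with core [c c'] and base [s]: the triples [a b c] and [a b' c'] form a cherry with
spine [a], and the other [t - 1] vertices of the kernel are spines with rich sides. *)
Lemma crossing_link a b b' c c' s : a \in loose -> b \in loose -> b' \in loose ->
  c \in tight -> c' \in tight -> b != b' -> c != c' -> h a b c -> h a b' c' -> s \in S ->
  ~~ h s c c'.
Proof.
move=> la lb lb' tc tc' bb' cc' hc hc' sS; apply/negP => hs; apply: no_book.
pose ps : seq (V * option V * option V) :=
  (a, Some b, Some b') :: [seq (x, None, None) | x <- enum (S :\ s)].
have EF : flatten (map (@partial_vertices V) ps) = [:: a, b, b' & enum (S :\ s)].
  rewrite /ps /= -map_comp (eq_map (g := fun x => [:: x])) //.
  by rewrite flatten_map1 map_id.
have tS x : x \in tight -> (x \notin S) * attached x by rewrite inE => /and3P[-> ->].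
have lS x : x \in loose -> x \notin S by rewrite inE => /andP[].
apply: (@complete_book _ h t c c' s ps).
- by rewrite /= size_map -cardE -cS (cardsD1 s S) sS.
- by rewrite adjR adjR.
- rewrite /= {1}/partial_cherry /= (adjR h c) hc (adjR h c') hc' /=.
  apply/allP => p /mapP[x]; rewrite mem_enum in_setD1 => /andP[_ xS] ->.
  by rewrite /partial_cherry /= !(attachedP _ xS) ?tS.
have sep x : x \notin S -> x \notin enum (S :\ s).
  by move=> xS; rewrite mem_enum in_setD1 (negbTE xS) andbF.
have sepS x : x \notin S -> x != s by apply: contraNneq => ->.
have sN : s \notin enum (S :\ s) by rewrite mem_enum in_setD1 eqxx.
rewrite EF /= !in_cons !negb_or enum_uniq sN (sep _ (tS _ tc).1) (sep _ (tS _ tc').1)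
  (sep _ (lS _ la)) (sep _ (lS _ lb)) (sep _ (lS _ lb')) /=.
have sepS' x : x \notin S -> s != x by rewrite eq_sym; apply: sepS.
rewrite cc' bb' (adj_neq12 hc) (adj_neq12 hc') (sepS c (tS c tc).1) (sepS c' (tS c' tc').1).
by rewrite !sepS' ?lS // !tight_loose.
Qed.

Definition tight_nbrs a := [set c in tight | [exists b in loose, h a b c]].
Definition thin_bound := 2 * eta + 2.
Definition thin a := #|tight_nbrs a| <= thin_bound.

(** With two different partners [b] and [b'], crossing leaves only tight neighbours of [a]
that are unlinked from [c] or from [c'], and these are few. *)
Lemma thick_single_partner a b b' c c' : a \in loose -> ~~ thin a ->
  b \in loose -> b' \in loose -> c \in tight -> c' \in tight ->
  h a b c -> h a b' c' -> b = b'.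
Proof.
move=> la thick lb lb' tc tc' hc hc'; apply/eqP; apply: contraR thick => bb'.
rewrite /thin; apply: (@leq_trans #|([set c; c'] :|: (unlinked c :|: unlinked c'))|).
  apply: subset_leq_card; apply/subsetP => x /setIdP[tx /existsP[y /andP[ly hx]]].
  rewrite in_setU in_set2 in_setU.
  have [//|/= xc] := boolP (x == c); have [//|/= xc'] := boolP (x == c').
  have [yb|yb] := eqVneq y b; last first.
    apply/orP; left; rewrite inE; apply/forallP => s; apply/implyP => sS.
    by apply: (crossing_link la lb ly tc tx _ _ hc hx sS); rewrite eq_sym.
  apply/orP; right; rewrite inE; apply/forallP => s; apply/implyP => sS.
  by apply: (crossing_link la lb' ly tc' tx _ _ hc' hx sS); rewrite ?yb eq_sym.
apply: leq_trans (leq_card_setU _ _) _; rewrite addnC leq_add //; last by rewrite cards2; case: (_ != _).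
apply: leq_trans (leq_card_setU _ _) _; rewrite mul2n -addnn.
by move: tc tc'; rewrite !inE => /and3P[_ _ ?] /and3P[_ _ ?]; rewrite leq_add.
Qed.

Definition loose_link a := \sum_(b in loose) \sum_(c in tight) h a b c.

(** Through its single loose partner a thick vertex has at most [n] triples; this is the main
term, half of what a loose vertex loses at the kernel. *)
Lemma thick_loose_link a : a \in loose -> ~~ thin a -> loose_link a <= n.
Proof.
move=> la thick.
have [[b /andP[lb /existsP[c /andP[tc hc]]]]|none] :=
  altP (@existsP _ (fun b => (b \in loose) && [exists c, (c \in tight) && h a b c])); last first.
  rewrite /loose_link big1 // => b lb; rewrite big1 // => c tc.
  by apply/eqP; rewrite eqb0; move/existsPn/(_ b): none; rewrite lb => /existsPn/(_ c); rewrite tc.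
rewrite /loose_link (bigD1 b) //= [X in _ + X]big1 ?addn0; last first.
  move=> b' /andP[lb' bb']; rewrite big1 // => c' tc'; apply/eqP; rewrite eqb0.
  by apply: contra bb' => hc'; rewrite (thick_single_partner la thick lb lb' tc tc' hc hc').
apply: (@leq_trans (\sum_(c in tight) 1)); first by apply: leq_sum => ? _; apply: leq_b1.
by rewrite sum1_card max_card.
Qed.

Lemma sum_loose_cut :
  \sum_(a in loose) \sum_(b in loose) \sum_(c in loose :|: slack) h a b c
    <= 6 * t * (2 * #|loose| * (#|loose| + #|slack|)).
Proof.
apply: leq_trans (sum_restrict_le _ _ _) _.
apply: leq_trans (leq_trans _ (triples_shadow _ t_gt0)) _; first exact: leqnn.
  by move/restrict_book.
rewrite leq_mul2l; apply/orP; right.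
set D := loose :|: slack.
apply: (@leq_trans #|setX loose D :|: setX D loose|).
  apply: subset_leq_card; apply/subsetP => -[x y]; rewrite inE => /card_gt0P[z].
  have sub u : u \in loose -> u \in D by move=> lu; rewrite in_setU lu.
  rewrite in_nbr /= => /andP[_] /or3P[]/and3P[H1 H2 H3]; rewrite in_setU !in_setX.
  - by rewrite H1 (sub _ H2).
  - by rewrite H1 H3.
  by rewrite H1 H3 orbT.
apply: leq_trans (leq_card_setU _ _) _; rewrite !cardsX (mulnC #|D|) addnn -mul2n -mulnA.
by rewrite leq_mul2l /= leq_mul2l leq_card_setU orbT.
Qed.

Let thins := [set a in loose | thin a].

Lemma sum_thin_thin :
  \sum_(a in thins) \sum_(b in thins) \sum_(c in tight) h a b c
    <= 6 * t * (#|loose| ^ 2 + 2 * #|loose| * thin_bound).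
Proof.
apply: leq_trans (sum_restrict_le _ _ _) _.
apply: leq_trans (leq_trans _ (triples_shadow _ t_gt0)) _; first exact: leqnn.
  by move/restrict_book.
rewrite leq_mul2l; apply/orP; right.
pose E := [set p : V * V | (p.1 \in thins) && (p.2 \in tight_nbrs p.1)].
pose E' := [set p : V * V | (p.2 \in thins) && (p.1 \in tight_nbrs p.2)].
have thl u : u \in thins -> u \in loose by case/setIdP.
have cT : #|thins| <= #|loose| by apply: subset_leq_card; apply/subsetP => u /thl.
have cE : #|E| <= #|loose| * thin_bound.
  rewrite -sum_predE -(pair_bigA _ (fun a c => ((a \in thins) && (c \in tight_nbrs a) : nat))) /=.
  apply: leq_trans (leq_mul cT (leqnn _)); rewrite -sum_nat_const [leqRHS]big_mkcond.
  apply: leq_sum => a _; case: (boolP (a \in thins)) => [ta|_]; last by rewrite big1.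
  by rewrite sum_mem; case/setIdP: ta.
have cE' : #|E'| <= #|loose| * thin_bound.
  have inj : injective (fun p : V * V => (p.2, p.1)) by move=> [? ?] [? ?] [-> ->].
  apply: leq_trans cE; rewrite -(card_imset (mem E') inj).
  by apply: subset_leq_card; apply/subsetP => _ /imsetP[[x y] + ->]; rewrite !inE.
apply: (@leq_trans #|setX thins thins :|: (E :|: E')|).
  apply: subset_leq_card; apply/subsetP => -[x y]; rewrite inE => /card_gt0P[z].
  rewrite in_nbr /= => /andP[hxy] /or3P[]/and3P[H1 H2 H3].
  - by rewrite in_setU in_setX H1 H2.
  - apply/setUP; right; apply/setUP; left; rewrite inE /= H1 /=; apply/setIdP; split=> //.
    by apply/existsP; exists z; rewrite (thl _ H2) adjA.
  apply/setUP; right; apply/setUP; right; rewrite inE /= H1 /=; apply/setIdP; split=> //.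
  by apply/existsP; exists z; rewrite (thl _ H2) adjA adjC.
apply: leq_trans (leq_card_setU _ _) _; rewrite cardsX -mulnn leq_add ?leq_mul //.
apply: leq_trans (leq_card_setU _ _) _; rewrite mul2n -addnn mulnDl.
exact: leq_add.
Qed.

(** A thick vertex has a single loose partner, and a thin one has few tight neighbours. *)
Lemma sum_thin_thick :
  \sum_(b in loose | ~~ thin b) \sum_(a in thins) \sum_(c in tight) h a b c
    <= #|loose| * thin_bound.
Proof.
rewrite -sum_nat_const big_mkcondr; apply: leq_sum => b lb; case: ifP => // thick.
have thl u : u \in thins -> u \in loose by case/setIdP.
have [/existsP[a /andP[ta /existsP[c /andP[tc hc]]]]|none] :=
  boolP [exists a, (a \in thins) && [exists c, (c \in tight) && h a b c]]; last first.
  rewrite big1 // => a ta; rewrite big1 // => c tc.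
  by apply/eqP; rewrite eqb0; move/existsPn/(_ a): none; rewrite ta => /existsPn/(_ c); rewrite tc.
rewrite (bigD1 a) //= [X in _ + X]big1 ?addn0; last first.
  move=> a' /andP[ta' aa']; rewrite big1 // => c' tc'; apply/eqP; rewrite eqb0.
  apply: contra aa' => hc'; apply/eqP.
  by apply: (thick_single_partner lb thick (thl _ ta') (thl _ ta) tc' tc); rewrite adjC.
apply: (@leq_trans #|tight_nbrs a|); last by case/setIdP: ta.
rewrite big_mkcond -sum_mem; apply: leq_sum => x _; case: (boolP (x \in tight)) => // tx.
case: (boolP (h a b x)) => // hx; rewrite (_ : x \in tight_nbrs a) //.
by apply/setIdP; split=> //; apply/existsP; exists b; rewrite lb.
Qed.

Lemma sum_loose_loose : \sum_(a in loose) \sum_(b in loose) \sum_(c in ~: S) h a b c <=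
  6 * t * (2 * #|loose| * (#|loose| + #|slack|)) + #|loose| * n + #|loose| * thin_bound +
  6 * t * (#|loose| ^ 2 + 2 * #|loose| * thin_bound).
Proof.
have split_c a b : \sum_(c in ~: S) h a b c <=
    \sum_(c in loose :|: slack) h a b c + \sum_(c in tight) h a b c.
  rewrite big_mkcond [X in _ <= X + _]big_mkcond [X in _ <= _ + X]big_mkcond -big_split.
  apply: leq_sum => c _ /=; rewrite !inE.
  by case: (c \in S) => //=; case: (attached c) => //=; [case: ltnP|] => /=; rewrite ?addn0 ?add0n.
apply: (@leq_trans (\sum_(a in loose) \sum_(b in loose) \sum_(c in loose :|: slack) h a b c +
    \sum_(a in loose) loose_link a)).
  rewrite -big_split; apply: leq_sum => a _; rewrite -big_split; apply: leq_sum => b _.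
  exact: split_c.
rewrite -!addnA leq_add ?sum_loose_cut // (bigID thin) /= addnC leq_add //.
  rewrite -sum_nat_const big_mkcondr; apply: leq_sum => a la.
  by case: ifP => // thick; apply: thick_loose_link.
rewrite (eq_bigl (mem thins)) => [|a]; last by rewrite !inE.
apply: (@leq_trans (\sum_(a in thins) (\sum_(b in loose | ~~ thin b) \sum_(c in tight) h a b c +
   \sum_(b in thins) \sum_(c in tight) h a b c))).
  apply: leq_sum => a _; rewrite /loose_link (bigID thin) /= addnC leq_add2l.
  by rewrite (eq_bigl (mem thins)) => [|b]; last by rewrite !inE.
rewrite big_split leq_add ?sum_thin_thin //.
by rewrite exchange_big; apply: sum_thin_thick.
Qed.

End Exact.

(** * The upper bound for triple systems *)

Section Deficit.

Variables (V : finType) (h : triple_system V) (t : nat).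
Hypothesis no_book : ~ has_book h t.
Hypothesis t_gt0 : 0 < t.
Variables (S : {set V}).
Hypothesis cS : #|S| = t.

Local Notation N := (nbr h).
Local Notation d := (codeg h).
Local Notation n := #|V|.
Local Notation attached := (attached h t S).
Local Notation loose := (loose h t S).

Definition star_triples := \sum_(s in S) \sum_(y in ~: S) \sum_(z in ~: S) h s y z.
Definition star_gaps := \sum_(s in S) \sum_(y in ~: S) \sum_(z in ~: S) ((y != z) && ~~ h s y z).
Definition loose_triples := \sum_(a in loose) \sum_(b in loose) \sum_(c in ~: S) h a b c.

Lemma star_triples_gaps : star_triples + star_gaps = t * ((n - t) * (n - t.+1)).
Proof.
have cSC : #|~: S| = n - t by rewrite cardsCs setCK cS.
rewrite -big_split -cS -sum_nat_const; apply: eq_bigr => s sS; rewrite -big_split cS -cSC -sum_nat_const.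
apply: eq_bigr => y ySC; rewrite -big_split /=.
rewrite subnS -cSC (cardsD1 y) ySC /= -sum1_card [RHS]big_mkcond [LHS]big_mkcond.
apply: eq_bigr => z _; rewrite in_setD1 eq_sym; case: (z \in ~: S); rewrite ?andbF ?andbT //.
have [->|_] := eqVneq y z; last by case: (adj _ _ _ _).
by rewrite /= addn0; case: (boolP (adj _ _ _ _)) => // /adj_neq23; rewrite eqxx.
Qed.

(** Every loose vertex has a poor pair with a vertex of the kernel. *)
Lemma star_gaps_ge : 2 * (#|loose| * (n - 4 * t - #|loose|)) <= star_gaps.
Proof.
pose D := ~: S :\: loose.
have DS z : z \in D -> z \notin S by rewrite inE in_setC => /andP[].
have lS y : y \in loose -> y \notin S by rewrite inE => /andP[].
have leD : n - t - #|loose| <= #|D|.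
  rewrite leq_subLR; have -> : n - t = #|~: S| by rewrite cardsCs setCK cS.
  by rewrite -(cardsID loose (~: S)) leq_add2r subset_leq_card // subsetIr.
(* A loose y has a poor pair y s with s in S, so s y z is a triple for few z. Each gap is
   met twice, as (y, z) and as (z, y). *)
have half : #|loose| * (n - 4 * t - #|loose|) <=
    \sum_(s in S) \sum_(y in loose) \sum_(z in D) ~~ h s y z.
  rewrite exchange_big /= -sum_nat_const; apply: leq_sum => y.
  rewrite inE => /andP[_ /subsetPn[s sS]]; rewrite inE -leqNgt => le_d.
  rewrite (bigD1 s) //=; apply: leq_trans (leq_addr _ _).
  apply: (@leq_trans #|D :\: N s y|).
    have := cardsID (N s y) D; have := subset_leq_card (subsetIr D (N s y)).
    rewrite -/(d s y) codegC; move: leD le_d; rewrite -/(d y s).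
    by move: #|D| #|_ :&: _| #|_ :\: _| (d y s) #|loose| #|V| => a b c e f g; clear; lia.
  rewrite [leqRHS]big_mkcond -sum_mem; apply: leq_sum => z _.
  by rewrite in_setD in_nbr; case: (z \in D); case: (adj _ _ _ _).
apply: (@leq_trans (\sum_(s in S) (\sum_(y in loose) \sum_(z in D) ~~ h s y z +
    \sum_(y in D) \sum_(z in loose) ~~ h s y z))).
  rewrite big_split mul2n -addnn leq_add //; apply: leq_trans half _; apply: leq_sum => s _.
  rewrite exchange_big /=; apply: leq_sum => z _; apply: leq_sum => y _.
  by rewrite adjA.
apply: leq_sum => s _; rewrite [leqRHS]big_mkcond [X in X + _]big_mkcond [X in _ + X]big_mkcond -big_split.
apply: leq_sum => y _; rewrite /D in_setD in_setC.
have [ly|ly] := boolP (y \in loose).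
  rewrite (lS _ ly) /= addn0 big_mkcond [leqRHS]big_mkcond; apply: leq_sum => z _.
  rewrite in_setD in_setC; have [lz|lz] := boolP (z \in loose) => //=.
  case: (z \in S) => //=; have [yz|_] := eqVneq y z => //.
  by rewrite yz (negbTE lz) in ly.
rewrite /= add0n; case: ifP => // yS; rewrite big_mkcond [leqRHS]big_mkcond; apply: leq_sum => z _.
have [lz|//] := boolP (z \in loose); rewrite in_setC (lS _ lz).
by have [yz|//] := eqVneq y z; rewrite yz lz in ly.
Qed.

Hypothesis many_attached : t < #|[set y | attached y]|.

(** A triple has at most one vertex in the kernel; one without vertices there has at least two
loose ones. The factor three counts the place of the distinguished vertex in an ordered triple. *)
Lemma triples_split : triples h <= 3 * (star_triples + loose_triples).
Proof.
pose G1 x y z := [&& x \in S, y \in ~: S, z \in ~: S & h x y z].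
pose G2 x y z := [&& x \in loose, y \in loose, z \in ~: S & h x y z].
have s1 : \sum_x \sum_y \sum_z (G1 x y z : nat) = star_triples.
  rewrite /star_triples [RHS]big_mkcond; apply: eq_bigr => x _; rewrite /G1.
  case: (x \in S); last by rewrite big1 // => y _; rewrite big1.
  rewrite [RHS]big_mkcond; apply: eq_bigr => y _.
  case: (y \in ~: S); last by rewrite big1.
  by rewrite [RHS]big_mkcond; apply: eq_bigr => z _; case: (z \in ~: S).
have s2 : \sum_x \sum_y \sum_z (G2 x y z : nat) = loose_triples.
  rewrite /loose_triples [RHS]big_mkcond; apply: eq_bigr => x _; rewrite /G2.
  case: (x \in loose); last by rewrite big1 // => y _; rewrite big1.
  rewrite [RHS]big_mkcond; apply: eq_bigr => y _.
  case: (y \in loose); last by rewrite big1.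
  by rewrite [RHS]big_mkcond; apply: eq_bigr => z _; case: (z \in ~: S).
have -> : triples h = \sum_x \sum_y \sum_z (h x y z : nat).
  by apply: eq_bigr => x _; apply: eq_bigr => y _; rewrite sum_predE.
have le x y z : h x y z <= (G1 x y z + G1 y x z + G1 z x y) + (G2 x y z + G2 x z y + G2 y z x).
  rewrite /G1 /G2 !in_setC (adjC h y x) (adjR h z x y) (adjA h x z y) -(adjR h x y z).
  case: (boolP (h x y z)) => // hxyz; rewrite !andbT.
  have pf u v w : h u v w -> ~~ ((u \in S) && (v \in S)).
    move=> huv; apply/negP => /andP[uS vS].
    by have := kernel_pair_free no_book w many_attached uS vS; rewrite huv.
  have := pf _ _ _ hxyz; have := pf x z y; rewrite adjA => /(_ hxyz).
  have := pf y z x; rewrite -adjR => /(_ hxyz).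
  have af u v w : h u v w -> u \notin S -> v \notin S -> w \notin S -> (u \in loose) || (v \in loose).
    move=> huv uS vS wS; rewrite !inE uS vS /= -negb_and; apply/negP => /andP[au av].
    by have := attached_pair_free no_book cS wS au av; rewrite huv.
  have := af _ _ _ hxyz; have := af x z y; rewrite adjA => /(_ hxyz).
  have := af y z x; rewrite -adjR => /(_ hxyz).
  case: (x \in S); case: (y \in S); case: (z \in S) => //= A1 A2 A3 _ _ _.
  move: (A1 isT isT isT) (A2 isT isT isT) (A3 isT isT isT).
  by case: (x \in loose); case: (y \in loose); case: (z \in loose).
apply: (@leq_trans (\sum_x \sum_y \sum_z
   ((G1 x y z + G1 y x z + G1 z x y) + (G2 x y z + G2 x z y + G2 y z x)))).
  by do 3!(apply: leq_sum => ? _); apply: le.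
rewrite !sum_triplesD s1 s2.
have -> : \sum_x \sum_y \sum_z (G1 y x z : nat) = star_triples by rewrite sum_triplesC.
have -> : \sum_x \sum_y \sum_z (G1 z x y : nat) = star_triples by rewrite sum_triplesA sum_triplesC.
have -> : \sum_x \sum_y \sum_z (G2 x z y : nat) = loose_triples by rewrite sum_triplesA.
have -> : \sum_x \sum_y \sum_z (G2 y z x : nat) = loose_triples by rewrite sum_triplesC sum_triplesA.
by clear; lia.
Qed.

End Deficit.

(** If the system is at least as large as claimed, it has a kernel, and then the gaps at the
kernel outweigh the triples among loose vertices. The constant [q] makes [eta] a small proportion
of [n], and [Q] makes the loose and slack vertices few even compared with it. *)
Theorem triples_upper_bound t : 0 < t -> exists n0, forall (V : finType) (h : triple_system V),
  n0 <= #|V| -> ~ has_book h t -> triples h <= 3 * t * (#|V| - t) * (#|V| - t.+1).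
Proof.
move=> t_gt0; pose q := 16 * (12 * t + 1); pose Q := q + 8 * (20 * t + 24 * t * q).
have q_gt0 : 0 < q by rewrite muln_gt0 addn1.
have Q_gt0 : 0 < Q by rewrite addn_gt0 q_gt0.
have [n1 n1P] := exists_kernel t_gt0 Q_gt0.
exists (n1 + q + 64 * t + 4) => V h le_n nb; rewrite leqNgt; apply/negP => ltV; move: (ltV); apply/negP.
rewrite -leqNgt; have [|S [cS le_nu le_U]] := n1P V h _ nb (ltnW ltV); first by move: le_n; clear; lia.
pose nu := #|[set y | ~~ (S \subset rich_nbrs h t y)]|; rewrite -/nu in le_nu.
pose e := #|V| %/ q; pose eta := 2 * e.
have n_gt0 : 0 < #|V| by move: le_n; clear; lia.
have n_le : #|V| <= 2 * q * e by apply: divn_ge_half => //; move: le_n; clear; lia.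
have e_gt0 : 0 < e by rewrite divn_gt0 //; move: le_n; clear; lia.
have qe_le : e * q <= #|V| by apply: leq_trunc_div.
have nu_le : nu <= e.
  by rewrite leq_divRL //; apply: leq_trans le_nu; rewrite mulnC leq_mul2r leq_addr orbT.
pose b := #|loose h t S|; pose mu := #|slack h t S eta|.
have b_le : b <= nu.
  by apply: subset_leq_card; apply/subsetP => y; rewrite !inE => /andP[].
(* If c is settled with x and both are attached, then N c x contains S; so a slack vertex
   lies in more than eta - nu >= e unsettled pairs. *)
have mu_le : mu * e <= unsettled_pairs h t.
  rewrite -sum_nat_const [leqRHS](bigID (mem (slack h t S eta))) /= -[leqLHS]addn0 leq_add //.
  apply: leq_sum => c; rewrite inE => /and3P[cNS ac lt_eta].
  have sub : unlinked h S c \subset [set x | ~~ settled h t c x] :|: [set y | ~~ (S \subset rich_nbrs h t y)].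
    apply/subsetP => x; rewrite !inE => /forallP un; rewrite -negb_and; apply/negP => /andP[].
    have /card_gt0P[s sS] : 0 < #|S| by rewrite cS.
    case/andP => /eqP eN _ ax; have := un s; rewrite sS /= adjR -in_nbr eN inE.
    by rewrite (subsetP ac) ?(subsetP ax).
  have := leq_trans (subset_leq_card sub) (leq_card_setU _ _); rewrite -/nu.
  by move: lt_eta nu_le; rewrite /eta; move: #|_| #|[set x | _]| => i j; clear; lia.
have many : t < #|[set y | attached h t S y]|.
  have : #|[set y | attached h t S y]| + nu = #|V|.
    rewrite -(cardsC [set y | attached h t S y]); congr (_ + _).
    by apply: eq_card => y; rewrite !inE.
  by move: nu_le qe_le le_n; rewrite /q; move: #|[set y | _]| => i; clear; nia.
have le_loose := sum_loose_loose nb t_gt0 eta cS.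
have gaps := star_gaps_ge h cS.
apply: leq_trans (triples_split nb cS many) _.
rewrite -!mulnA leq_mul2l /= -(star_triples_gaps h cS) leq_add2l.
apply: leq_trans le_loose (leq_trans _ gaps); rewrite -/b -/mu.
have Qmu : Q * mu <= 2 * q * #|V|.
  rewrite -(leq_pmul2r e_gt0) -mulnA; apply: leq_trans (leq_mul (leqnn Q) mu_le) _.
  apply: leq_trans le_U _; rewrite -mulnn mulnAC leq_mul2r n_le orbT //.
have Qb : Q * b <= #|V| by apply: leq_trans le_nu; rewrite leq_mul2l b_le orbT.
have small : 8 * (20 * t * b + 12 * t * mu) <= #|V|.
  rewrite -(leq_pmul2l Q_gt0); apply: (@leq_trans (8 * (20 * t + 24 * t * q) * #|V|)); last first.
    by rewrite leq_mul2r leq_addl orbT.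
  apply: (@leq_trans (8 * (20 * t) * (Q * b) + 8 * (12 * t) * (Q * mu))).
    by rewrite leq_eqVlt; apply/orP; left; apply/eqP; move: (Q) => k; ring.
  apply: leq_trans (leq_add (leq_mul (leqnn _) Qb) (leq_mul (leqnn _) Qmu)) _.
  by rewrite leq_eqVlt; apply/orP; left; apply/eqP; move: (q) #|V| => k n; ring.
rewrite /thin_bound.
have {}qe_le : 4 * ((12 * t + 1) * (4 * e)) <= #|V|.
  by apply: leq_trans qe_le; rewrite /q; clear; lia.
have le_tb : b <= t * b by rewrite leq_pmull.
have le_n' : 64 * t + 4 <= #|V| by move: le_n; clear; lia.
(* All error terms of the loose triples together stay below the room left by the gaps. *)
have sum_le : 12 * t * (b + mu) + (2 * eta + 2) + 6 * t * b + 12 * t * (2 * eta + 2) + 8 * t + 2 * b <= #|V|.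
  by move: small qe_le le_n' le_tb; rewrite /eta; move: #|V| => n; clear; lia.
have gap_ge : 12 * t * (b + mu) + #|V| + (2 * eta + 2) + 6 * t * b + 12 * t * (2 * eta + 2) <=
    2 * (#|V| - 4 * t - b).
  by move: sum_le; clear; lia.
rewrite [leqRHS]mulnCA; apply: leq_trans (leq_mul (leqnn b) gap_ge).
rewrite leq_eqVlt; apply/orP; left; apply/eqP.
by move: #|V| (2 * eta + 2) => n L; ring.
Qed.

(** * From hypergraphs to triple systems *)

Section TripleSystemOfHypergraph.

Variables (V : finType) (H : hypergraph V).
Hypothesis H3 : uniform 3 H.

Lemma hyperedge_card e : e \in H -> #|e| = 3.
Proof. by move=> eH; move/forallP/(_ e): H3; rewrite eH => /eqP. Qed.

Lemma hyperedgeC x y z : ([set x; y; z] \in H) = ([set y; x; z] \in H).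
Proof. by rewrite (setUC [set x]). Qed.

Lemma hyperedgeA x y z : ([set x; y; z] \in H) = ([set x; z; y] \in H).
Proof. by rewrite setUAC. Qed.

Lemma hyperedge_neq x y z : [set x; y; z] \in H -> x != y.
Proof.
move/hyperedge_card; apply: contra_eqN => /eqP->; rewrite setUid cards2.
by case: (y != z).
Qed.

Definition triple_system_of := TripleSystem hyperedgeC hyperedgeA hyperedge_neq.

Lemma set3_eq (e : {set V}) x y z : #|e| = 3 ->
  ([set x; y; z] == e) = [&& x \in e, y \in e :\ x & z \in e :\ x :\ y].
Proof.
move=> e3; apply/eqP/and3P => [def_e|[xe ye ze]].
  have xy : x != y.
    by move: e3; rewrite -def_e; apply: contra_eqN => /eqP->; rewrite setUid cards2; case: (y != z).
  have xz : x != z.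
    by move: e3; rewrite -def_e setUAC; apply: contra_eqN => /eqP->; rewrite setUid cards2; case: (z != y).
  have yz : y != z.
    move: e3; rewrite -def_e -setUA; apply: contra_eqN => /eqP->.
    by rewrite setUid cards2; case: (x != z).
  by split; rewrite -def_e !inE ?(eq_sym y x) ?(eq_sym z x) ?(eq_sym z y) ?xy ?xz ?yz ?eqxx ?orbT.
move: ye ze; rewrite !in_setD1 => /andP[yx ye] /and3P[zy zx ze].
apply/eqP; rewrite eqEcard; apply/andP; split.
  by apply/subsetP => u; rewrite !inE -orbA => /or3P[]/eqP->.
by rewrite e3 setUC cardsU1 cards2 !inE negb_or zx zy eq_sym yx.
Qed.

(** Each hyperedge is listed by its six orderings. *)
Lemma triples_of_hypergraph : triples triple_system_of = 6 * #|H|.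
Proof.
rewrite /triples mulnC -sum_nat_const.
transitivity (\sum_x \sum_y \sum_z \sum_(e in H) ([set x; y; z] == e : nat)).
  apply: eq_bigr => x _; apply: eq_bigr => y _; rewrite /codeg -sum_mem.
  apply: eq_bigr => z _; rewrite inE /=; case: (boolP (_ \in H)) => [eH|eNH].
    rewrite (bigD1 [set x; y; z]) //= eqxx big1 // => e /andP[_].
    by rewrite eq_sym => /negbTE->.
  by rewrite big1 // => e eH; case: eqP eNH => // ->; rewrite eH.
under eq_bigr => x _ do (under eq_bigr => y _ do rewrite exchange_big /=; rewrite exchange_big /=).
rewrite exchange_big /=; apply: eq_bigr => e /hyperedge_card e3.
transitivity (\sum_(x in e) \sum_(y in e :\ x) \sum_(z in e :\ x :\ y) 1).
  rewrite [RHS]big_mkcond; apply: eq_bigr => x _.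
  have [xe|xe] := boolP (x \in e); last first.
    by rewrite big1 // => y _; rewrite big1 // => z _; rewrite set3_eq // (negbTE xe).
  rewrite [RHS]big_mkcond; apply: eq_bigr => y _.
  have [ye|ye] := boolP (y \in e :\ x); last first.
    by rewrite big1 // => z _; rewrite set3_eq // (negbTE ye) andbF.
  by rewrite [RHS]big_mkcond; apply: eq_bigr => z _; rewrite set3_eq // xe ye; case: (_ \in _).
have card_del (A : {set V}) x k : #|A| = k.+1 -> x \in A -> #|A :\ x| = k.
  by move=> cA xA; move: cA; rewrite (cardsD1 x) xA => -[].
transitivity (\sum_(x in e) 2); last by rewrite sum_nat_const e3.
apply: eq_bigr => x xe; have ex2 := card_del _ _ _ e3 xe.
transitivity (\sum_(y in e :\ x) 1); last by rewrite sum1_card.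
by apply: eq_bigr => y ye; rewrite sum1_card (card_del _ _ _ ex2 ye).
Qed.

End TripleSystemOfHypergraph.

Section BookEdges.

Variable t : nat.
Local Notation BV := (bool + 'I_t)%type.

Lemma base_in_book : [set inl true; inl false] \in book t.
Proof. by rewrite !inE eqxx. Qed.

Lemma side_in_book b i : [set inl b; inr i] \in book t.
Proof. by rewrite !inE; apply/orP; right; apply/imset2P; exists b i. Qed.

Lemma bookP e : e \in book t ->
  e = [set inl true; inl false] \/ exists b i, e = [set inl b; inr i].
Proof.
by rewrite !inE => /orP[/eqP|/imset2P[b i _ _ ->]]; [left | right; exists b, i].
Qed.

Definition base : {e : {set BV} | e \in book t} := exist (fun e => is_true (e \in book t)) _ base_in_book.
Definition side b i : {e : {set BV} | e \in book t} := exist (fun e => is_true (e \in book t)) _ (side_in_book b i).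

Definition extra (e : {e : {set BV} | e \in book t}) : expansion_vertex 3 (book t) := inr (e, ord0).
Definition core (b : bool) : expansion_vertex 3 (book t) := inl (inl b).
Definition spine (i : 'I_t) : expansion_vertex 3 (book t) := inl (inr i).

Lemma base_edge : [set core true; core false; extra base] \in expansion 3 (book t).
Proof.
apply/imsetP; exists base => //; rewrite /= imsetU !imset_set1; congr (_ :|: _).
by apply/setP => x; rewrite inE; apply/eqP/imsetP => [->|[i _ ->]]; [exists ord0 | rewrite (ord1 i)].
Qed.

Lemma side_edge b i : [set core b; spine i; extra (side b i)] \in expansion 3 (book t).
Proof.
apply/imsetP; exists (side b i) => //; rewrite /= imsetU !imset_set1; congr (_ :|: _).
by apply/setP => x; rewrite inE; apply/eqP/imsetP => [->|[j _ ->]]; [exists ord0 | rewrite (ord1 j)].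
Qed.

Lemma expansion_bookP E : E \in expansion 3 (book t) ->
  E = [set core true; core false; extra base] \/ exists b i, E = [set core b; spine i; extra (side b i)].
Proof.
case/imsetP => e _ ->.
have -> : [set inr (e, i) | i : 'I_(3 - 2)] = [set extra e] :> {set expansion_vertex 3 (book t)}.
  by apply/setP => x; rewrite inE; apply/imsetP/eqP => [[i _ ->]|->]; [rewrite (ord1 i) | exists ord0].
case: (bookP (valP e)) => [def_e|[b [i def_e]]]; [left | right; exists b, i].
  by rewrite (_ : e = base); [rewrite /= imsetU !imset_set1 | apply: val_inj].
by rewrite (_ : e = side b i); [rewrite /= imsetU !imset_set1 | apply: val_inj].
Qed.

Lemma base_neq_side b i : base != side b i.
Proof.
apply/eqP => /(congr1 val)/= /setP/(_ (inr i)).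
by rewrite !inE eqxx orbT.
Qed.

Lemma side_inj b b' i i' : side b i = side b' i' -> b = b' /\ i = i'.
Proof.
move/(congr1 val) => /= /setP E; split.
  by have := E (inl b); rewrite !inE eqxx /= orbF => /esym/eqP[].
by have := E (inr i); rewrite !inE eqxx /= => /esym/eqP[].
Qed.

Lemma extra_inj : injective extra.
Proof.
by move=> e e' /(congr1 (fun x => if x is inr p then p.1 else base)).
Qed.

End BookEdges.

(** * Copies of the expanded book *)

Section BookEmbedding.

Variable t : nat.
Local Notation EV := (expansion_vertex 3 (book t)).

(** The index of a vertex of the expansion in the list [u, v, w, s_0, e_0, f_0, s_1, ...] of the
vertices of a book given by cherries. The edge that an added vertex belongs to is recognised by
[pick], since edges are bare sets. *)
Definition position (x : EV) : nat :=
  match x with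
  | inl (inl b) => ~~ b
  | inl (inr i) => 3 + 3 * i
  | inr (e, _) =>
    if [pick p | e == side p.1 p.2] is Some p then 3 + 3 * p.2 + 1 + ~~ p.1 else 2
  end.

Lemma position_base : position (extra (base t)) = 2.
Proof. by rewrite /=; case: pickP => // p; rewrite (negbTE (base_neq_side _ _)). Qed.

Lemma position_side b (i : 'I_t) : position (extra (side b i)) = 3 + 3 * i + 1 + ~~ b.
Proof.
rewrite /=; case: pickP => [[b' i'] /eqP/side_inj[-> ->]//|/(_ (b, i))].
by rewrite /= eqxx.
Qed.

Lemma expansion_book_vertexP (x : EV) :
  [\/ exists b, x = core t b, exists i, x = spine i, x = extra (base t)
    | exists b i, x = extra (side b i)].
Proof.
case: x => [[b|i]|[e k]]; [by constructor 1; exists b | by constructor 2; exists i |].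
rewrite (ord1 k); case: (bookP (valP e)) => [def_e|[b [i def_e]]].
  by constructor 3; congr (inr (_, _)); apply: val_inj.
by constructor 4; exists b, i; congr (inr (_, _)); apply: val_inj.
Qed.

Lemma position_inj : injective position.
Proof.
move=> x y.
have ordE (i j : 'I_t) : i = j :> nat -> i = j by apply: ord_inj.
case: (expansion_book_vertexP x) => [[b ->]|[i ->]|->|[b [i ->]]];
  case: (expansion_book_vertexP y) => [[c ->]|[j ->]|->|[c [j ->]]];
  rewrite ?position_base ?position_side //= => E.
- by case: b c E => [] [].
- by exfalso; case: b E.
- by exfalso; case: b E.
- by exfalso; case: b E.
- by exfalso; case: c E.
- by congr spine; apply: ordE; move: E; clear; lia.
- by exfalso; move: E; clear; case: c; lia.
- by exfalso; case: c E.
- by exfalso; move: E; clear; case: c; lia.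
- by exfalso; move: E; clear; case: b; lia.
have -> : i = j by apply: ordE; move: E; clear; case: b c => [] []; lia.
by congr (extra (side _ _)); move: E; clear; case: b c => [] []; lia.
Qed.

Lemma position_lt x : position x < 3 + 3 * t.
Proof.
case: (expansion_book_vertexP x) => [[b ->]|[i ->]|->|[b [i ->]]];
  rewrite ?position_base ?position_side //=.
- by case: b; lia.
- by have := ltn_ord i; lia.
- by have := ltn_ord i; case: b; lia.
Qed.

Lemma nth_cherries (V : finType) (x : V) (c0 : V * V * V) cs i k : k < 3 -> i < size cs ->
  nth x (flatten (map (@cherry_vertices V) cs)) (3 * i + k) = nth x (cherry_vertices (nth c0 cs i)) k.
Proof.
move=> k3; elim: cs i => [//|c cs IH] [_|i i_lt]; first by rewrite muln0; case: k k3 {IH} => [|[|[|]]].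
by rewrite mulnS -addnA; apply: IH.
Qed.

Lemma book_contained (V : finType) (H : hypergraph V) (H3 : uniform 3 H) :
  has_book (triple_system_of H3) t -> contains (expansion 3 (book t)) H.
Proof.
case=> u [v [w [cs [cs_t uvw /allP ch]]]].
set L := [:: u, v, w & _] => uniqL.
have sizeL : size L = 3 + 3 * t.
  rewrite /L /= -cs_t; congr (_.+3); elim: (cs) => //= c cs' ->; lia.
pose f := [ffun x : EV => nth u L (position x)].
apply/existsP; exists f; apply/andP; split.
  apply/injectiveP => x y; rewrite !ffunE => /eqP.
  by rewrite nth_uniq ?sizeL ?position_lt // => /eqP/position_inj.
have fcore b : f (core t b) = if b then u else v by rewrite ffunE; case: b.
have fbase : f (extra (base t)) = w by rewrite ffunE position_base.
pose c i := nth (u, u, u) cs i.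
have nthL (i : 'I_t) k : k < 3 -> nth u L (3 + 3 * i + k) = nth u (cherry_vertices (c i)) k.
  by move=> k3; rewrite -addnA; apply: nth_cherries; rewrite ?cs_t.
have fspine (i : 'I_t) : f (spine i) = (c i).1.1.
  by rewrite ffunE; have := nthL i 0 isT; rewrite addn0.
have fside b (i : 'I_t) : f (extra (side b i)) = if b then (c i).1.2 else (c i).2.
  by rewrite ffunE position_side -addnA nthL; case: b.
apply/forall_inP => E /expansion_bookP[->|[b [i ->]]]; rewrite !imsetU !imset_set1 fcore.
  by rewrite fcore fbase.
rewrite fspine fside; have /ch/andP[] : c i \in cs by rewrite mem_nth ?cs_t.
by case: b.
Qed.

End BookEmbedding.

(** * The crosscut construction and the theorem *)

(** If the crosscut contains a core vertex, it misses the other one and all [x_i], so it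
contains the vertex added to each edge at the other core vertex. If not, it contains the vertex
added to the core edge, and for every [i] either [x_i] or the vertex added to [u x_i]. *)
Lemma card_crosscut t (X : {set expansion_vertex 3 (book t)}) :
  {in expansion 3 (book t), forall E, #|E :&: X| = 1} -> t < #|X|.
Proof.
move=> cut.
have uniq_sel E x y : E \in expansion 3 (book t) -> x \in E -> y \in E -> x \in X -> y \in X -> x = y.
  move=> /cut/eqP/cards1P[z Ez] xE yE xX yX.
  have : x \in E :&: X by rewrite in_setI xE.
  have : y \in E :&: X by rewrite in_setI yE.
  by rewrite Ez => /set1P-> /set1P.
have some_sel x y z : [set x; y; z] \in expansion 3 (book t) -> [|| x \in X, y \in X | z \in X].
  move=> /cut/eqP/cards1P[u Eu]; have : u \in [set x; y; z] :&: X by rewrite Eu set11.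
  by rewrite !inE -orbA => /andP[/or3P[]/eqP-> ->]; rewrite ?orbT.
suff [g g_inj gX] : exists2 g : option 'I_t -> expansion_vertex 3 (book t),
    injective g & forall o, g o \in X.
  have <- : #|[set: option 'I_t]| = t.+1 by rewrite cardsT card_option card_ord.
  rewrite -(card_imset _ g_inj); apply/subset_leq_card/subsetP => _ /imsetP[o _ ->].
  exact: gX.
have [/existsP[b bX]|no_core] := boolP [exists b, core t b \in X].
  exists (fun o => if o is Some i then extra (side (~~ b) i) else core t b).
    by case=> [i|] [j|] // /extra_inj/side_inj[_ ->].
  case=> // i; have bS : spine i \notin X.
    by apply/negP => /(uniq_sel _ _ _ (side_edge b i)) => /(_ (core t b)); rewrite !inE !eqxx ?orbT => /(_ isT isT bX).
  have bN : core t (~~ b) \notin X.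
    apply/negP => /(uniq_sel _ _ _ (base_edge t)) => /(_ (core t b)).
    by rewrite !inE; case: (b) bX => bX; rewrite !eqxx ?orbT => /(_ isT isT bX).
  by have := some_sel _ _ _ (side_edge (~~ b) i); rewrite (negbTE bS) (negbTE bN).
have coreN b : (core t b \in X) = false by apply: contraNF no_core => bX; apply/existsP; exists b.
exists (fun o => if o is Some i then if spine i \in X then spine i else extra (side true i)
                 else extra (base t)).
  case=> [i|] [j|] //.
  - case: ifP => _; case: ifP => _ //; first by case=> ->.
    by move=> /extra_inj/side_inj[_ ->].
  - by case: ifP => // _ /extra_inj/eqP; rewrite eq_sym (negbTE (base_neq_side _ _)).
  - by case: ifP => // _ /extra_inj/eqP; rewrite (negbTE (base_neq_side _ _)).
case=> [i|].
  by have := some_sel _ _ _ (side_edge true i); rewrite coreN; case: ifP.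
by have := some_sel _ _ _ (base_edge t); rewrite !coreN.
Qed.

Section CrosscutConstruction.

Variables (V : finType) (S : {set V}) (t : nat).
Hypothesis cS : #|S| = t.

Definition crosscut_triples : hypergraph V := [set e : {set V} | (#|e| == 3) && (#|e :&: S| == 1)].

Lemma crosscut_triples_uniform : uniform 3 crosscut_triples.
Proof. by apply/forall_inP => e; rewrite inE => /andP[]. Qed.

Lemma crosscut_triples_bookless : ~~ contains (expansion 3 (book t)) crosscut_triples.
Proof.
apply/existsP => -[f /andP[/injectiveP f_inj /forall_inP fH]].
suff : t < #|f @^-1: S|.
  apply/negP; rewrite -leqNgt; apply: (@leq_trans #|S|); last by rewrite cS.
  rewrite -(card_imset _ f_inj); apply/subset_leq_card/subsetP.
  by move=> _ /imsetP[x + ->]; rewrite inE.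
apply: card_crosscut => E /fH; rewrite inE => /andP[_ /eqP cE].
rewrite -(card_imset _ f_inj) -[RHS]cE; congr #|pred_of_set _|; apply/setP => y; rewrite inE.
apply/imsetP/andP => [[x + ->]|[/imsetP[x xE ->] xS]].
  by rewrite !inE => /andP[xE xS]; rewrite imset_f.
by exists x; rewrite // !inE xE.
Qed.

Lemma card_crosscut_triples : t * 'C(#|V| - t, 2) <= #|crosscut_triples|.
Proof.
pose P := setX S [set A : {set V} | A \subset ~: S & #|A| == 2].
have <- : #|P| = t * 'C(#|V| - t, 2) by rewrite cardsX cards_draws (cardsCs (~: S)) setCK cS.
have recover s (A : {set V}) : s \in S -> A \subset ~: S -> (s |: A) :&: S = [set s] /\ (s |: A) :\: S = A.
  move=> sS /subsetP AS; split; apply/setP => x; rewrite !inE.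
    have [->|/= ] := eqVneq x s; first by rewrite sS.
    by move=> _; apply/negbTE/negP => /andP[/AS]; rewrite inE => /negbTE->.
  have [->|/= _] := eqVneq x s; first by rewrite sS /=; apply/esym/negP => /AS; rewrite inE sS.
  by apply/andP/idP => [[]//|xA]; have := AS _ xA; rewrite inE.
have P_inj : {in P &, injective (fun p : V * {set V} => p.1 |: p.2)}.
  move=> [s A] [s' A']; rewrite !inE /= => /and3P[sS AS _] /and3P[sS' AS' _] E.
  have [e1 e2] := recover _ _ sS AS; have [e1' e2'] := recover _ _ sS' AS'.
  by congr pair; [apply/set1_inj; rewrite -e1 E | rewrite -e2 E].
rewrite -(card_in_imset P_inj); apply/subset_leq_card/subsetP => _ /imsetP[[s A] + ->].
rewrite !inE /= => /and3P[sS AS /eqP cA]; have [-> _] := recover _ _ sS AS.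
rewrite cards1 cardsU1 cA (_ : s \notin A) //.
by apply/negP => /(subsetP AS); rewrite inE sS.
Qed.

End CrosscutConstruction.

Theorem theorem1p1 (t : nat) (ht : 1 < t) :
  exists n0 : nat, forall n : nat, n0 <= n ->
    turan_number 3 n (expansion 3 (book t)) = t * 'C(n - t, 2).
Proof.
have [n0 upper] := triples_upper_bound (ltnW ht).
exists (n0 + t) => n le_n; apply/eqP; rewrite eqn_leq; apply/andP; split.
  apply/bigmax_leqP => H /andP[H3 bookless].
  have := upper _ (triple_system_of H3); rewrite card_ord triples_of_hypergraph.
  move=> /(_ (leq_trans (leq_addr _ _) le_n)).
  have -> : 3 * t * (n - t) * (n - t.+1) = 6 * (t * 'C(n - t, 2)).
    have := mul_bin_diag (n - t) 1; rewrite bin1 subnS; move: (n - t) 'C(_, _) => m c; clear.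
    move=> E; have -> : 3 * t * m * m.-1 = 3 * t * (m * m.-1) by ring.
    by rewrite E; ring.
  rewrite leq_pmul2l //; apply; apply: contraNnot bookless; exact: book_contained.
have tn : t <= #|'I_n| by rewrite card_ord; apply: leq_trans le_n; apply: leq_addl.
have [S _ cS] : exists2 S : {set 'I_n}, true & #|S| = t.
  have /set0Pn[S] : [set A : {set 'I_n} | A \subset setT & #|A| == t] != set0.
    by rewrite -cards_eq0 cards_draws cardsT -lt0n bin_gt0.
  by rewrite inE => /andP[_ /eqP]; exists S.
have := card_crosscut_triples cS; rewrite card_ord => /leq_trans; apply.
have bookless := crosscut_triples_bookless cS; have H3 := crosscut_triples_uniform S.
rewrite /turan_number (bigD1 (crosscut_triples S)) ?H3 //=; apply: leq_maxl.
Qed.
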